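(* Let $\mu>-1$ and let $\{P_n(\cdot;\mu)\}_{n\ge 0}$ be the threefold symmetric polynomial sequence defined by $P_0(x)=1$, $P_1(x)=x$, $P_2(x)=x^2$ and $P_{n+1}(x)=xP_n(x)-\gamma_{n-1}P_{n-2}(x)$ for $n\ge 2$, where $$\gamma_{2n+1}=\frac23\,\frac{(n+1)(2n+1)}{3n+\mu+2},\qquad \gamma_{2n+2}=\frac23\,\frac{(n+1)(2n+3)(n+\mu+1)}{(3n+\mu+2)(3n+\mu+5)},\qquad n\ge 0 .$$ Then $\{P_n(\cdot;\mu)\}_{n\ge0}$ is $2$-orthogonal with respect to the pair of linear functionals $(u_0,u_1)$ given, for every polynomial $f$ and $k=0,1$, by $$\langle u_k,f\rangle=\frac13\left(\int_0^{\infty}f(x)\,\mathcal U_k(x)\,dx+\omega^{2k-1}\int_0^{\infty\omega}f(x)\,\mathcal U_k(\omega^2x)\,dx+\omega^{1-2k}\int_0^{\infty\omega^2}f(x)\,\mathcal U_k(\omega x)\,dx\right),$$ where $\omega=e^{2\pi i/3}$ and, for $x>0$, $$\mathcal U_0(x)=\frac{3\,\Gamma(\frac{\mu+2}{3})}{\Gamma(\frac13)\Gamma(\frac23)}\,e^{-x^3}\,\mathbf U\!\left(\tfrac{\mu}{3},\tfrac23;x^3\right),\qquad \mathcal U_1(x)=\frac{9\,\Gamma(\frac{\mu+5}{3})}{\Gamma(\frac13)\Gamma(\frac23)}\,x^2e^{-x^3}\,\mathbf U\!\left(\tfrac{\mu}{3}+1,\tfrac53;x^3\right).$$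
   Context: $\mathbf U(a,b;x)$ is the Kummer (confluent hypergeometric) function of the second kind; for $\Re a>0$ and $|\arg x|<\pi/2$, $\mathbf U(a,b;x)=\frac1{\Gamma(a)}\int_0^\infty t^{a-1}(t+1)^{b-a-1}e^{-tx}\,dt$, and it is defined for other $a$ by analytic continuation in $a$ (with $\mathbf U(0,b;x)=1$). The integrals $\int_0^{\infty\omega^j}$ are along the rays $\{t\omega^j:t\ge0\}$, on which the arguments $\omega^2x$, $\omega x$ of $\mathcal U_k$ are nonnegative reals. A sequence of monic polynomials $\{P_n\}_{n\ge0}$ ($\deg P_n=n$) is $2$-orthogonal with respect to $(u_0,u_1)$ if for all $m,n\ge 0$: $\langle u_0,x^mP_n\rangle=0$ if $n\ge 2m+1$ and $\langle u_0,x^mP_{2m}\rangle\neq 0$; $\langle u_1,x^mP_n\rangle=0$ if $n\ge 2m+2$ and $\langle u_1,x^mP_{2m+1}\rangle\ne 0$. Threefold symmetric means $P_n(\omega x)=\omega^nP_n(x)$ for all $n$. *)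

(* Defs.v *)
From HB Require Import structures.
From mathcomp Require Export all_boot all_order all_algebra.
From mathcomp Require Export complex.
From mathcomp Require Export all_classical all_reals all_analysis.
Export Order.TTheory GRing.Theory Num.Theory.
Export numFieldNormedType.Exports.

Set Implicit Arguments.
Unset Strict Implicit.
Unset Printing Implicit Defensive.

Local Open Scope classical_set_scope.
Local Open Scope ring_scope.
Local Open Scope complex_scope.

(* Meaningful for 0 < a, where the integral converges. *)
Definition Gamma (R : realType) (a : R) : R :=
  \int[@lebesgue_measure R]_(t in `]0, +oo[) (t `^ (a - 1) * expR (- t)).

Definition real_analytic (R : realType) (f : R -> R) : Prop :=
  forall a0 : R, exists2 r : R, 0 < r &
    exists c : R^nat, forall a : R, `|a - a0| < r ->
      series (fun k => c k * (a - a0) ^+ k) @ \oo --> f a.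

Definition kummerU_integral (R : realType) (a b x : R) : R :=
  (Gamma a)^-1 * \int[@lebesgue_measure R]_(t in `]0, +oo[)
    (t `^ (a - 1) * (t + 1) `^ (b - a - 1) * expR (- (t * x))).

Definition kummerU_continuation (R : realType) (b x : R) (f : R -> R) : Prop :=
  real_analytic f /\ forall a : R, 0 < a -> f a = kummerU_integral a b x.

(* For real parameters a, b and an argument x > 0, the integral is convergent
   for every a > 0, and as a function of a it extends to an entire function,
   so that its real-analytic continuation to the whole line exists; it is
   unique by the identity theorem, and [xget] selects it.
   The value is meaningless for x <= 0. *)
Definition kummerU (R : realType) (a b x : R) : R :=
  xget (fun=> 0) [set f | kummerU_continuation b x f] a.

Definition calU0 (R : realType) (mu x : R) : R :=
  3 * Gamma ((mu + 2) / 3) / (Gamma (1 / 3) * Gamma (2 / 3))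
  * expR (- x ^+ 3) * kummerU (mu / 3) (2 / 3) (x ^+ 3).

Definition calU1 (R : realType) (mu x : R) : R :=
  9 * Gamma ((mu + 5) / 3) / (Gamma (1 / 3) * Gamma (2 / 3))
  * x ^+ 2 * expR (- x ^+ 3) * kummerU (mu / 3 + 1) (5 / 3) (x ^+ 3).

(* The weights only make sense at positive reals. They are extended to complex
   arguments through the real part, and are only ever evaluated at arguments
   that are positive reals (t, omega^2 * (t * omega), omega * (t * omega^2)). *)
Definition calU (R : realType) (mu : R) (k : 'I_2) (z : R[i]) : R[i] :=
  (if k == ord0 then calU0 mu (complex.Re z) else calU1 mu (complex.Re z))%:C.

(* exp (2 * pi * i / 3) *)
Definition omega (R : realType) : R[i] :=
  cos (2 * pi / 3) +i* sin (2 * pi / 3).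

Definition ray_integrable (R : realType) (w : R[i]) (g : R[i] -> R[i]) : Prop :=
  (@lebesgue_measure R).-integrable `]0, +oo[
    (EFin \o (fun t : R => complex.Re (g (t%:C * w)))) /\
  (@lebesgue_measure R).-integrable `]0, +oo[
    (EFin \o (fun t : R => complex.Im (g (t%:C * w)))).

(* The contour integral of g along the ray { t * w : t > 0 }, parametrized by
   z = t * w, dz = w dt. *)
Definition ray_integral (R : realType) (w : R[i]) (g : R[i] -> R[i]) : R[i] :=
  w * ((\int[@lebesgue_measure R]_(t in `]0, +oo[) complex.Re (g (t%:C * w)))
       +i* (\int[@lebesgue_measure R]_(t in `]0, +oo[) complex.Im (g (t%:C * w)))).

Definition functional_integrable (R : realType) (mu : R) (k : 'I_2)
    (f : {poly R[i]}) : Prop :=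
  [/\ ray_integrable 1 (fun z => f.[z] * calU mu k z),
      ray_integrable (omega R)
        (fun z => f.[z] * calU mu k (omega R ^+ 2 * z)) &
      ray_integrable (omega R ^+ 2)
        (fun z => f.[z] * calU mu k (omega R * z))].

(* The exponents 2k - 1 and 1 - 2k are integers, possibly negative. *)
Definition functional (R : realType) (mu : R) (k : 'I_2)
    (f : {poly R[i]}) : R[i] :=
  3^-1 *
  (ray_integral 1 (fun z => f.[z] * calU mu k z)
   + omega R ^ (2 * (k : nat)%:Z - 1)
     * ray_integral (omega R)
         (fun z => f.[z] * calU mu k (omega R ^+ 2 * z))
   + omega R ^ (1 - 2 * (k : nat)%:Z)
     * ray_integral (omega R ^+ 2)
         (fun z => f.[z] * calU mu k (omega R * z))).

Definition two_orthogonal (C : fieldType) (u0 u1 : {poly C} -> C)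
    (P : nat -> {poly C}) : Prop :=
  [/\ forall n, P n \is monic /\ size (P n) = n.+1,
      scalar u0 /\ scalar u1,
      forall m n, (2 * m + 1 <= n)%N -> u0 ('X^m * P n) = 0,
      forall m, u0 ('X^m * P (2 * m)%N) != 0 &
      (forall m n, (2 * m + 2 <= n)%N -> u1 ('X^m * P n) = 0) /\
      (forall m, u1 ('X^m * P (2 * m + 1)%N) != 0)].

Definition threefold_symmetric (R : realType) (P : nat -> {poly R[i]}) : Prop :=
  forall (n : nat) (x : R[i]), (P n).[omega R * x] = omega R ^+ n * (P n).[x].

(* Main.v *)
Require Import Defs.
From mathcomp Require Import ring lra zify measurable_realfun.
Local Open Scope classical_set_scope.
Local Open Scope ring_scope.
Local Open Scope complex_scope.

Set Implicit Arguments.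
Unset Strict Implicit.
Unset Printing Implicit Defensive.

(* The monic polynomials are P_n = sum_k a(n,k) x^(n-3k) with hypergeometric
   coefficients a(n,k), which is checked against the recurrence. Rotating the
   rays, <u_k, x^i> vanishes unless i = k mod 3, and Tonelli's theorem turns
   the remaining moments into Beta integrals,
     <u_k, x^(3m+k)> = (3m+k)! / (27^m m! ((mu+2)/3+k)_m).
   Hence for n = 3j+k with j > 0, <u_k, P_n> is, up to a constant, the j-th
   finite difference of a polynomial of degree < j, so that
   <u_k, P_n> = [n = k]; 2-orthogonality follows from this duality and
   x P_n = P_(n+1) + gamma_(n-1) P_(n-2).

   For a = mu/3 in (-1/3, 0] the Kummer function is only known as an analytic
   continuation in a. For a > 0 it is a quotient of two power series (the
   integral and Gamma), and the contiguity relation between a, a+1 and a+2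
   extends it to the whole line; by the identity theorem this is the function
   selected by kummerU, which is thus explicit for a > -1. *)

(** * The polynomials *)

(** The coefficients and the moments interlock. For [n = 3j + r] and [k + m = j], the moment of
    order [3m + r] carries the first [m] factors of a rising factorial of [(mu+2)/3 + r], and the
    denominator of the coefficient carries the last [k] factors. The gap between them has about
    [j/2] factors and is the polynomial in [m] that the [j]-th difference kills.

    The moment of a Kummer weight contains no [Gamma a]: the normalisation [1 / Gamma a] cancels the
    one produced by the Beta integral. The formula therefore keeps its meaning for [a <= 0], where
    the integral for the Kummer function diverges. Instead of continuing the moment itself in [a],
    contiguity writes it as a combination of three moments with parameters [a + 1] and [a + 2], and
    the functional equation of [Gamma] recombines them.

    Since [kummerU] is a choice made by [xget], nothing is known of its values until a continuation
    has been exhibited. The integral is divided by [Gamma a] and the contiguity coefficients depend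
    on [a], so convergent power series must be shown stable under products and reciprocals. *)

Section vandermonde.
Variable R : numDomainType.

Definition rising (c : R) (n : nat) : R := \prod_(i < n) (c + i%:R).

Lemma rising0 c : rising c 0 = 1.
Proof. by rewrite /rising big_ord0. Qed.

Lemma risingSr c n : rising c n.+1 = rising c n * (c + n%:R).
Proof. by rewrite /rising big_ord_recr. Qed.

Lemma risingSl c n : rising c n.+1 = c * rising (c + 1) n.
Proof.
rewrite /rising big_ord_recl addr0; congr (_ * _).
by apply: eq_bigr => i _; rewrite lift0 -[in LHS]natr1 addrA addrAC.
Qed.

Lemma risingD c m n : rising c (m + n) = rising c m * rising (c + m%:R) n.
Proof.
elim: n => [|n IH]; first by rewrite addn0 rising0 mulr1.
by rewrite addnS !risingSr IH natrD -!mulrA addrA.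
Qed.

Lemma rising_gt0 c n : 0 < c -> 0 < rising c n.
Proof. by move=> c0; apply: prodr_gt0 => i _; rewrite ltr_wpDr. Qed.

(** Pascal's rule. Passing from [j.+1] to [j] replaces [g] by its difference, so that iteration
    yields the [j]-th finite difference. *)
Lemma alternating_binomialS (g : nat -> R) j :
  \sum_(m < j.+2) (-1) ^+ m * 'C(j.+1, m)%:R * g m =
  \sum_(m < j.+1) (-1) ^+ m * 'C(j, m)%:R * (g m - g m.+1).
Proof.
under [RHS]eq_bigr do rewrite mulrBr.
rewrite sumrB big_ord_recl bin0 [in LHS]big_ord_recr /= binn.
rewrite [X in _ = X - _]big_ord_recl [X in _ = _ - X]big_ord_recr /= !bin0 binn.
rewrite -!addrA; congr (_ + _); rewrite opprD addrA.
congr (_ + _); last by rewrite exprS !mulr1 mulN1r mulNr.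
rewrite -sumrB; apply: eq_bigr => i _.
by rewrite /bump /= add1n binS natrD exprS; ring.
Qed.

(** In the variable [m] the rising factorial is a polynomial of degree [i]. Its difference is again
    a rising factorial, one factor shorter and with base shifted by one, up to the constant
    [- i.+1]. The induction thus stays inside this family. *)
Lemma alternating_rising (i j : nat) (c : R) : (i < j)%N ->
  \sum_(m < j.+1) (-1) ^+ m * 'C(j, m)%:R * rising (c + m%:R) i = 0.
Proof.
elim: i j c => [|i IH] [|j] c //.
  move=> _; rewrite (alternating_binomialS (fun m => rising (c + m%:R) 0)).
  by apply: big1 => m _; rewrite !rising0 subrr mulr0.
rewrite ltnS => ij; rewrite (alternating_binomialS (fun m => rising (c + m%:R) i.+1)).
under eq_bigr => m _.
  rewrite (_ : rising _ _ - _ = - i.+1%:R * rising (c + 1 + m%:R) i); last first.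
    rewrite risingSl risingSr -natr1 addrA (addrAC c 1) -(natr1 i).
    ring.
  rewrite mulrCA; over.
by rewrite -mulr_sumr IH// mulr0.
Qed.

End vandermonde.

(** * Closed form of the coefficients, and duality with the moments *)

Section hypergeometric_polynomials.
Variable R : numFieldType.
Variable mu : R.
Hypothesis hmu : -1 < mu.

(** The dependence on [n] through [n./2] alone mirrors the two formulas for [gamma]: the denominator
    is the same for [2p] and [2p + 1] and changes only at the next step. *)
Definition hden (n k : nat) : R := \prod_(i < k) (mu - 1 + 3 * (n./2)%:R - 3 * i%:R).

Definition hcoef (n k : nat) : R :=
  (-1) ^+ k * (n ^_ (3 * k))%:R / (9 ^+ k * k`!%:R * hden n k).

Lemma hcoef0 n : hcoef n 0 = 1.
Proof. by rewrite /hcoef /hden muln0 ffactn0 big_ord0 !expr0 fact0 !mulr1 divr1. Qed.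

Lemma hcoef_small n k : (n < 3 * k)%N -> hcoef n k = 0.
Proof. by move=> nk; rewrite /hcoef ffact_small// mulr0 mul0r. Qed.

(** As [i.+1 <= n./2], the factor is at least [mu + 2]. Outside the range [3 * i.+1 <= n] a factor
    can vanish, but there the falling factorial in [hcoef] is zero. *)
Lemma hden_factor_gt0 n i : (3 * i.+1 <= n)%N -> 0 < mu - 1 + 3 * (n./2)%:R - 3 * i%:R.
Proof.
move=> h; have : (i.+1 <= n./2)%N by lia.
rewrite -(ler_nat R) -natr1 => h2; move: hmu h2; set y := _./2%:R; set z := i%:R => h1 h2.
have -> : mu - 1 + 3 * y - 3 * z = (mu + 1) + 1 + 3 * (y - (z + 1)) by ring.
by rewrite ltr_wpDr ?mulr_ge0 ?subr_ge0// addr_gt0// -(opprK 1) subr_gt0.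
Qed.

Lemma hden_neq0 n k : (3 * k <= n)%N -> hden n k != 0.
Proof.
move=> h; rewrite prodf_seq_neq0; apply/allP => i _ /=.
by apply/lt0r_neq0/hden_factor_gt0; apply: leq_trans h; rewrite leq_mul.
Qed.


Lemma hden_even m k : hden (m.+2) k.+1 = (mu + 2 + 3 * (m./2)%:R) * hden m k.
Proof.
rewrite /hden big_ord_recl /= -natr1; congr (_ * _); first by ring.
by apply: eq_bigr => i _; rewrite /bump /= add1n -natr1; ring.
Qed.

Lemma hdenSr m k : hden m k.+1 = hden m k * (mu - 1 + 3 * (m./2)%:R - 3 * k%:R).
Proof. by rewrite /hden big_ord_recr. Qed.

Lemma hdenE m n k : m./2 = n./2 -> hden m k = hden n k.
Proof. by rewrite /hden => ->. Qed.

Lemma den_gt0 p : 0 < 3 * p%:R + mu + 2.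
Proof.
rewrite (_ : _ + 2 = 3 * p%:R + (mu + 1) + 1); last by ring.
by rewrite addr_gt0// ltr_wpDl ?mulr_ge0// -(opprK 1) subr_gt0.
Qed.

Let ffact_aux n k : (3 * k <= n)%N ->
  [/\ ((n.+3 ^_ (3 * k.+1))%:R = (n%:R + 3) * (n%:R + 2) * (n%:R + 1) * (n ^_ (3 * k))%:R :> R)
    & ((n.+2 ^_ (3 * k.+1))%:R = (n%:R + 2) * (n%:R + 1) * (n ^_ (3 * k))%:R * (n%:R - 3 * k%:R) :> R)].
Proof.
move=> h; rewrite (_ : 3 * k.+1 = (3 * k).+3)%N; last by lia.
split.
  by rewrite !ffactSS !natrM; ring.
rewrite ffactnSr !ffactSS (_ : (n.+2 - (3 * k).+2 = n - 3 * k)%N); last by lia.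
by rewrite !natrM natrB// natrM; ring.
Qed.

(** The indices [2p + 2] and [2p + 3] have the same half, so their denominators agree and only the
    falling factorials differ. What remains is a rational identity. *)
Lemma hcoef_rec_even p k :
  hcoef (2 * p + 3) k.+1 = hcoef (2 * p + 2) k.+1
    - 2 / 3 * ((p%:R + 1) * (2 * p%:R + 1)) / (3 * p%:R + mu + 2) * hcoef (2 * p) k.
Proof.
have [h|h] := leqP (3 * k) (2 * p); last first.
  by rewrite !hcoef_small ?mulr0 ?subrr//; lia.
have [h1 h2] := ffact_aux h.
rewrite /hcoef addn3 addn2 h1 h2.
rewrite (@hdenE (2 * p).+3 (2 * p).+2); last by lia.
rewrite hden_even mul2n doubleK -mul2n.
have G0 := hden_neq0 h.
have A0 := lt0r_neq0 (den_gt0 p).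
rewrite factS natrM -natr1 ![_ ^+ k.+1]exprS.
have k0 : (k%:R + 1 : R) != 0 by rewrite natr1 pnatr_eq0.
have k1 : k`!%:R != 0 :> R by rewrite pnatr_eq0 -lt0n fact_gt0.
have k9 : 9 ^+ k != 0 :> R by rewrite expf_neq0// pnatr_eq0.
field.
by rewrite G0 k1 k9 A0 addrC k0.
Qed.

(** Here the halves of [2p + 3] and [2p + 4] differ. All denominators are reduced to
    [hden (2p + 1) k] before the rational identity is checked. *)
Lemma hcoef_rec_odd p k :
  hcoef (2 * p + 4) k.+1 = hcoef (2 * p + 3) k.+1
    - 2 / 3 * ((p%:R + 1) * (2 * p%:R + 3) * (p%:R + mu + 1))
        / ((3 * p%:R + mu + 2) * (3 * p%:R + mu + 5)) * hcoef (2 * p + 1) k.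
Proof.
have [h|h] := leqP (3 * k) (2 * p + 1); last first.
  by rewrite !hcoef_small ?mulr0 ?subrr//; lia.
have [] := ffact_aux h.
rewrite (_ : (2 * p + 1).+3 = 2 * p + 4)%N; last by lia.
rewrite (_ : (2 * p + 1).+2 = 2 * p + 3)%N; last by lia.
move=> h1 h2; rewrite /hcoef h1 h2.
have G0 := hden_neq0 h.
have A0 := lt0r_neq0 (den_gt0 p).
have B0 : 3 * p%:R + mu + 5 != 0.
  have := lt0r_neq0 (den_gt0 p.+1); rewrite -natr1.
  by apply: contra_neq => e; rewrite -[RHS]e; ring.
have p1 : (2 * p + 1)./2 = p by lia.
have p2 : (2 * p + 2)./2 = p.+1 by lia.
have e1 : hden (2 * p + 3) k.+1 = (mu + 2 + 3 * p%:R) * hden (2 * p + 1) k.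
  by rewrite (_ : (2 * p + 3 = (2 * p + 1).+2)%N) ?hden_even ?p1//; lia.
have e2 : hden (2 * p + 4) k.+1 = (mu + 2 + 3 * p%:R + 3) * hden (2 * p + 2) k.
  rewrite (_ : (2 * p + 4 = (2 * p + 2).+2)%N) ?hden_even ?p2; last by lia.
  by rewrite -natr1; congr (_ * _); ring.
(* The product of [e1] is now split at its last factor instead of its first. Comparing both
   splittings gives [e4]. *)
have e3 : hden (2 * p + 3) k.+1 = hden (2 * p + 2) k * (mu + 2 + 3 * p%:R - 3 * k%:R).
  rewrite (@hdenE _ (2 * p + 2)) ?hdenSr ?p2 -?natr1; last by lia.
  by congr (_ * _); ring.
(* The bound [3k <= 2p + 1] gives [k <= p], so this is [3(p - k) + mu + 2], a positive number. *)
have K0 : mu + 2 + 3 * p%:R - 3 * k%:R != 0.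
  have := lt0r_neq0 (den_gt0 (p - k)); rewrite natrB; last by lia.
  by apply: contra_neq => e; rewrite -[RHS]e; ring.
have e4 : hden (2 * p + 2) k =
    (mu + 2 + 3 * p%:R) * hden (2 * p + 1) k / (mu + 2 + 3 * p%:R - 3 * k%:R).
  by rewrite -e1 e3 mulfK.
rewrite e2 e1 e4 factS natrM -natr1 ![_ ^+ k.+1]exprS.
have k0 : (k%:R + 1 : R) != 0 by rewrite natr1 pnatr_eq0.
have k1 : k`!%:R != 0 :> R by rewrite pnatr_eq0 -lt0n fact_gt0.
have k9 : 9 ^+ k != 0 :> R by rewrite expf_neq0// pnatr_eq0.
rewrite natrD natrM; field.
by rewrite G0 k1 k9 A0 B0 K0 addrC k0.
Qed.

Variable gamma : nat -> R.
Hypothesis gamma_odd : forall n : nat,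
  gamma (2 * n + 1)%N =
    2 / 3 * ((n%:R + 1) * (2 * n%:R + 1)) / (3 * n%:R + mu + 2).
Hypothesis gamma_even : forall n : nat,
  gamma (2 * n + 2)%N =
    2 / 3 * ((n%:R + 1) * (2 * n%:R + 3) * (n%:R + mu + 1))
          / ((3 * n%:R + mu + 2) * (3 * n%:R + mu + 5)).

Lemma gamma_neq0 n : (0 < n)%N -> gamma n != 0.
Proof.
move=> n0; have [p [] ->] : exists p, n = (2 * p + 1)%N \/ n = (2 * p + 2)%N.
- by exists (n.-1)./2; lia.
- by rewrite gamma_odd -natrM !natr1 -!natrM lt0r_neq0// divr_gt0 ?natrM ?den_gt0.
- have m1 : 0 < p%:R + mu + 1.
    by rewrite -addrA ltr_wpDl// -(opprK 1) subr_gt0.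
  have m5 : 0 < 3 * p%:R + mu + 5.
    by rewrite (_ : _ + 5 = 3 * p.+1%:R + mu + 2) ?den_gt0// -natr1; ring.
  rewrite gamma_even -natrM !natr1 -natrD lt0r_neq0// divr_gt0//.
    by rewrite !mulr_gt0// ?divr_gt0// ltr0n addn3.
  by rewrite mulr_gt0// ?natrM ?den_gt0.
Qed.

Lemma hcoef_rec n k : (2 <= n)%N ->
  hcoef n.+1 k.+1 = hcoef n k.+1 - gamma (n - 1) * hcoef (n - 2) k.
Proof.
move=> n2; have [p [] ->] : exists p, n = (2 * p + 2)%N \/ n = (2 * p + 3)%N.
- by exists ((n.-2)./2); lia.
- rewrite (_ : _ - 1 = 2 * p + 1)%N ?gamma_odd; last by lia.
  by rewrite addnK -addnS hcoef_rec_even.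
- rewrite (_ : _ - 1 = 2 * p + 2)%N ?gamma_even; last by lia.
  rewrite (_ : _ - 2 = 2 * p + 1)%N; last by lia.
  by rewrite -addnS hcoef_rec_odd.
Qed.

Variable P : nat -> {poly R}.
Hypotheses (P0 : P 0%N = 1) (P1 : P 1%N = 'X) (P2 : P 2%N = 'X^2).
Hypothesis PS : forall n : nat, (2 <= n)%N ->
  P (n + 1)%N = 'X * P n - gamma (n - 1)%N *: P (n - 2)%N.

(** Strong induction along the recurrence. Summing up to [k = n] adds only zero terms, since
    [hcoef n k = 0] for [3k > n]; these are also the terms in which the exponent [n - 3k] is
    truncated. *)
Lemma hpolyE n : P n = \sum_(k < n.+1) hcoef n k *: 'X^(n - 3 * k).
Proof.
have [m] := ubnP n; elim: m n => // m IH [|[|[|n]]] nm.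
- by rewrite P0 big_ord1 hcoef0 scale1r.
- rewrite P1 !big_ord_recl big_ord0 hcoef0 hcoef_small//.
  by rewrite scale1r scale0r !addr0.
- rewrite P2 !big_ord_recl big_ord0 hcoef0 !hcoef_small//.
  by rewrite scale1r !scale0r !addr0.
rewrite -(addn1 n.+2) PS// (IH n.+2)// (IH (n.+2 - 2)%N); last by lia.
rewrite addn1 !subSS subn0.
rewrite mulr_sumr scaler_sumr.
(* Both sums are padded with vanishing terms and the second is shifted by one in [k], so that
   [hcoef_rec] applies term by term. *)
transitivity (\sum_(k < n.+4) hcoef n.+2 k *: 'X^(n.+3 - 3 * k) -
   \sum_(k < n.+3) (gamma n.+1 * hcoef n k) *: 'X^(n.+3 - 3 * k.+1)).
  congr (_ - _).
    rewrite [RHS]big_ord_recr /= hcoef_small ?scale0r ?addr0; last by lia.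
    apply: eq_bigr => k _; have [h|h] := leqP (3 * k) n.+2.
      by rewrite -scalerAr -exprS (subSn h).
    by rewrite hcoef_small// !scale0r mulr0.
  rewrite [RHS]big_ord_recr [in RHS]big_ord_recr /= !hcoef_small ?mulr0 ?scale0r ?addr0; try lia.
  rewrite !subn0; apply: eq_bigr => k _; rewrite scalerA; do 2 congr (_ _); lia.
rewrite big_ord_recl [RHS]big_ord_recl !hcoef0 -addrA; congr (_ + _).
rewrite -sumrB; apply: eq_bigr => k _.
by rewrite -scalerBl !lift0; congr (_ *: _); rewrite [RHS]hcoef_rec// subn1 subn2.
Qed.


Lemma hdenE_rising n k :
  hden n k = 3 ^+ k * rising ((mu - 1) / 3 + (n./2)%:R - k%:R + 1) k.
Proof.
rewrite /hden /rising (reindex_inj rev_ord_inj) /=.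
have -> : 3 ^+ k = \prod_(i < k) 3 :> R by rewrite prodr_const card_ord.
rewrite -big_split/=; apply: eq_bigr => i _.
by rewrite natrB// -natr1; field.
Qed.

(** The moment contributes [rising c m], the coefficient [rising (c + m + i) k]; inserting the
    missing [rising (c + m) i] completes them to [rising c (i + (k + m))], which depends on [k + m]
    only. The offset [i] is what remains of [n./2 = k + m + (k + m + r)./2] once [r] has moved into
    [c]; the subtraction is not truncated because [0 < k + m]. *)
Lemma hcoef_moment r k m :
  let n := (3 * (k + m) + r)%N in
  let i := ((k + m + r)./2 - r)%N in
  let c := (mu + 2) / 3 + r%:R in
  (r < 2)%N -> (0 < k + m)%N ->
  hcoef n k * ((3 * m + r)`!%:R / (27 ^+ m * m`!%:R * rising c m)) =
  (-1) ^+ (k + m) * n`!%:R / (27 ^+ (k + m) * (k + m)`!%:R * rising c (i + (k + m)))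
  * ((-1) ^+ m * 'C(k + m, m)%:R * rising (c + m%:R) i).
Proof.
move=> n i c r2 km0.
have c0 : 0 < c.
  rewrite ltr_wpDr// divr_gt0// (_ : mu + 2 = mu + 1 + 1); last by ring.
  by rewrite addr_gt0// -(opprK 1) subr_gt0.
rewrite /hcoef hdenE_rising.
rewrite (_ : _ + 1 = c + m%:R + i%:R); last first.
  rewrite /c /i natrB; last by lia.
  rewrite (_ : n./2 = k + m + (k + m + r)./2)%N ?natrD; last by rewrite /n; lia.
  by field.
have -> : n`!%:R = (n ^_ (3 * k))%:R * (3 * m + r)`!%:R :> R.
  rewrite -(@ffact_fact n (3 * k)) ?natrM; last by rewrite /n; lia.
  by congr (_ * _`!%:R); rewrite /n; lia.
rewrite -(@bin_fact (k + m) m) ?leq_addl// addnK !natrM.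
rewrite (_ : i + (k + m) = m + i + k)%N; last by lia.
rewrite !risingD natrD addrA.
have h x l : 0 < x -> rising x l != 0 :> R by move=> x0; apply/lt0r_neq0/rising_gt0.
have h0 := h _ m c0.
have h1 : rising (c + m%:R) i != 0 by rewrite h// ltr_wpDr.
have h2 : rising (c + m%:R + i%:R) k != 0 by rewrite h// ltr_wpDr// ltr_wpDr.
have fk0 l : l`!%:R != 0 :> R by rewrite pnatr_eq0 -lt0n fact_gt0.
have C0 : 'C(k + m, m)%:R != 0 :> R by rewrite pnatr_eq0 -lt0n bin_gt0 leq_addl.
have n0 l a : l.+1%:R ^+ a != 0 :> R by rewrite expf_neq0// pnatr_eq0.
rewrite !exprD -!mulrA; congr (_ * _); rewrite !mulrA.
rewrite (_ : 27 ^+ k = 9 ^+ k * 3 ^+ k); last by rewrite -exprMn -natrM.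
by rewrite -signr_odd; case: (odd m); rewrite ?expr1 ?expr0; field;
  rewrite h0 h1 h2 !fk0 C0 !n0.
Qed.

Lemma scalar_sum (L : {poly R} -> R) (I : Type) (s : seq I) (a : I -> R) (q : I -> {poly R}) :
  scalar L -> L (\sum_(i <- s) a i *: q i) = \sum_(i <- s) a i * L (q i).
Proof.
move=> Ls; elim: s => [|x s IH]; last by rewrite !big_cons Ls IH.
rewrite !big_nil; have := Ls (-1) 0 0.
by rewrite scaler0 addr0 mulN1r addNr.
Qed.

(** If [n] is in another residue class than [r], no monomial of [P n] meets the support of [L]. If
    [n = 3j + r] with [j > 0], reversing the sum and applying [hcoef_moment] leaves a vanishing
    [j]-th difference, as [i < j]. For [j = 0] the value is [r!], which is 1 because [r < 2]. *)
Lemma hpoly_dual (L : {poly R} -> R) r n :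
  (r < 2)%N -> scalar L ->
  (forall i, (i %% 3)%N != r -> L 'X^i = 0) ->
  (forall m, L 'X^(3 * m + r) =
     (3 * m + r)`!%:R / (27 ^+ m * m`!%:R * rising ((mu + 2) / 3 + r%:R) m)) ->
  L (P n) = (n == r)%:R.
Proof.
move=> r2 Ls L0 Lr; rewrite hpolyE scalar_sum//.
have [nr|nr] := eqVneq (n %% 3)%N r; last first.
  rewrite big1; first by have [e|//] := eqVneq n r; move: nr; rewrite e modn_small ?eqxx//; lia.
  move=> k _; have [h|h] := leqP (3 * k) n; last by rewrite hcoef_small ?mul0r.
  rewrite L0 ?mulr0//; apply: contra_neq nr => <-.
  by rewrite -[in LHS](subnK h) addnC mulnC modnMDl.
have [j nE] : exists j, n = (3 * j + r)%N by exists (n %/ 3)%N; lia.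
rewrite {nr}nE; have [->|j0] := posnP j.
  rewrite muln0 add0n eqxx big_ord_recl big1 ?addr0.
    rewrite hcoef0 mul1r muln0 subn0 -{1}(add0n r) -{1}(muln0 3) Lr.
    by rewrite muln0 add0n fact0 rising0 expr0 !mulr1 divr1; case: (r) r2 => [|[]].
  by move=> k _; rewrite hcoef_small ?mul0r// lift0; lia.
rewrite (_ : _ == r = false) ?mulr0n; last by apply/negbTE; lia.
rewrite -(big_mkord xpredT (fun k => hcoef _ k * L 'X^(_ - 3 * k))).
rewrite (@big_cat_nat _ _ _ j.+1)//=; last by lia.
rewrite [X in _ + X]big_nat_cond [X in _ + X]big1 ?addr0; last first.
  by move=> k; rewrite andbT => /andP[h _]; rewrite hcoef_small ?mul0r//; lia.
rewrite big_mkord (reindex_inj rev_ord_inj)/=.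
under eq_bigr => m _.
  rewrite subSS.
  have mj : (m <= j)%N by rewrite -ltnS.
  rewrite (_ : 3 * j + r - 3 * (j - m) = 3 * m + r)%N; last by lia.
  rewrite Lr -{1}(subnK mj) hcoef_moment ?subnK//.
  over.
by rewrite -mulr_sumr alternating_rising ?mulr0//; lia.
Qed.

Lemma hpoly_size_monic n : P n \is monic /\ size (P n) = n.+1.
Proof.
have [m] := ubnP n; elim: m n => // m IH [|[|[|n]]] nm.
- by rewrite P0 monic1 size_poly1.
- by rewrite P1 monicX size_polyX.
- by rewrite P2 monicXn size_polyXn.
have [|m2 s2] := IH n.+2; first by lia.
have [|_ s0] := IH n; first by lia.
rewrite -(addn1 n.+2) PS// !subSS !subn0.
have s1 : (size (- (gamma n.+1 *: P n))%R < size ('X * P n.+2)%R)%N.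
  rewrite mulrC size_mulX -?size_poly_eq0 s2// size_polyN.
  by rewrite (leq_ltn_trans (size_scale_leq _ _)) ?s0//; lia.
have ms : 'X * P n.+2 \is monic by rewrite mulrC monicMr ?monicX.
split; first by rewrite monicE (lead_coefDl s1) -monicE.
by rewrite (size_polyDl s1) mulrC size_mulX -?size_poly_eq0 s2 ?addn1.
Qed.

(** Multiplication by ['X] moves the index of [P] up by one or down by two, so at least [m] downward
    moves are needed to descend from [2m + r] to [r]. At [n = 2m + r] exactly one path arrives, and
    it contributes a product of nonzero values of [gamma]. *)
Lemma dual_orthogonal (L : {poly R} -> R) r : scalar L ->
  (forall n, L (P n) = (n == r)%:R) ->
  forall m : nat, (forall n : nat, (2 * m + r < n)%N -> L ('X^m * P n) = 0) /\
    L ('X^m * P (2 * m + r)%N) != 0.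
Proof.
move=> Ls Lr; elim=> [|m [IH0 IH1]].
  split=> [n h|]; first by rewrite expr0 mul1r Lr gtn_eqF.
  by rewrite expr0 mul1r Lr eqxx oner_neq0.
have rec n : (2 <= n)%N -> L ('X^(m.+1) * P n) =
    gamma (n - 1)%N * L ('X^m * P (n - 2)%N) + L ('X^m * P (n + 1)%N).
  move=> n2; rewrite -Ls; congr L.
  by rewrite PS// mulrBr -scalerAr addrC subrK mulrA -exprSr.
split=> [n h|].
  by rewrite rec ?IH0 ?mulr0 ?addr0//; lia.
rewrite rec; last by lia.
rewrite [X in _ + X]IH0 ?addr0; last by lia.
rewrite mulf_neq0 ?gamma_neq0//; first by lia.
by rewrite (_ : 2 * m.+1 + r - 2 = 2 * m + r)%N//; lia.
Qed.

Theorem hpoly_two_orthogonal (u0 u1 : {poly R} -> R) : scalar u0 -> scalar u1 ->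
  (forall n, u0 (P n) = (n == 0)%:R) -> (forall n, u1 (P n) = (n == 1)%:R) ->
  two_orthogonal u0 u1 P.
Proof.
move=> s0 s1 h0 h1; have H0 := dual_orthogonal s0 h0; have H1 := dual_orthogonal s1 h1.
split=> //; first exact: hpoly_size_monic.
- by move=> m n h; apply: (H0 m).1; lia.
- by move=> m; have := (H0 m).2; rewrite addn0.
- split=> m; last exact: (H1 m).2.
  by move=> n h; apply: (H1 m).1; lia.
Qed.

End hypergeometric_polynomials.

(** * Real-analytic functions *)

Section cauchy_product.
Variable R : realType.
Implicit Types (x y : R^nat) (p K L : R).

Definition convolution x y : R^nat := fun n => \sum_(k < n.+1) x k * y (n - k)%N.

Lemma series_convolution x y n :
  series (convolution x y) n = \sum_(i < n) \sum_(0 <= j < n - i) x i * y j.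
Proof.
rewrite seriesEord /=; elim: n => [|n IH]; first by rewrite !big_ord0.
rewrite big_ord_recr /= IH [RHS]big_ord_recr /= subSnn big_nat1.
rewrite /convolution big_ord_recr /= subnn addrA; congr (_ + _).
rewrite -big_split/=; apply: eq_bigr => i _.
by rewrite subSn ?big_nat_recr//= ltnW.
Qed.

Lemma geo_sum_le p n : 0 <= p < 1 -> \sum_(0 <= k < n) p ^+ k <= (1 - p)^-1.
Proof.
move=> /andP[p0 p1]; rewrite -[leRHS]mul1r ler_pdivlMr ?subr_gt0//.
rewrite big_mkord mulrC -opprB mulNr -subrX1 opprB lerBlDr lerDl.
by rewrite exprn_ge0.
Qed.

(** The product of the partial sums minus the partial sum of the convolution runs over pairs with
    [i + j >= n]. There one copy of [p ^+ (i + j)] is at most [p ^+ n], and the other copy keeps the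
    double sum bounded; this is why the hypotheses ask for the square of [p ^+ k]. *)
Lemma cauchy_product x y K L p (A B : R) :
  0 <= p < 1 ->
  (forall k, `|x k| <= K * (p ^+ k * p ^+ k)) ->
  (forall k, `|y k| <= L * (p ^+ k * p ^+ k)) ->
  series x @ \oo --> A -> series y @ \oo --> B ->
  series (convolution x y) @ \oo --> A * B.
Proof.
move=> p01 xK yL xA yB; have /andP[p0 p1] := p01.
have K0 : 0 <= K by have := xK 0%N; rewrite expr0 !mulr1; exact: le_trans.
have L0 : 0 <= L by have := yL 0%N; rewrite expr0 !mulr1; exact: le_trans.
have xy : series x n * series y n @[n --> \oo] --> A * B by exact: cvgM.
suff H : series x n * series y n - series (convolution x y) n @[n --> \oo] --> 0.
  rewrite -[A * B]subr0 (_ : series (convolution x y) = fun n =>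
    series x n * series y n - (series x n * series y n - series (convolution x y) n)).
    exact: cvgB.
  by apply/funext => n; rewrite opprB addrC subrK.
apply/cvgr0Pnorm_le => /= e e0.
pose M := K * L * ((1 - p)^-1 * (1 - p)^-1).
have := @cvg_geometric R M p; rewrite ger0_norm// => /(_ p1).
move=> /cvgr0Pnorm_le /(_ e e0).
apply: filterS => n; apply: le_trans.
rewrite /geometric/= series_convolution !seriesEord/= mulr_suml -sumrB.
rewrite (le_trans (ler_norm_sum _ _ _))//.
apply: le_trans (ler_norm _).
apply: (@le_trans _ _ (\sum_(i < n) (K * L * (1 - p)^-1) * p ^+ n * p ^+ i)).
  apply: ler_sum => i _.
  rewrite mulr_sumr -(big_mkord xpredT (fun j => x i * y j)).
  rewrite (@big_cat_nat _ _ _ (n - i))//= ?leq_subr// addrAC subrr add0r.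
  rewrite (le_trans (ler_norm_sum _ _ _))//.
  rewrite [leRHS](_ : _ = K * L * p ^+ n * p ^+ i * (1 - p)^-1); last by ring.
  apply: (@le_trans _ _ (\sum_(n - i <= j < n) K * L * p ^+ n * p ^+ i * p ^+ j)).
    rewrite big_nat_cond [leRHS]big_nat_cond; apply: ler_sum => j.
    rewrite andbT => /andP[j1 j2]; rewrite normrM.
    apply: (le_trans (ler_pM _ _ (xK i) (yL j))) => //.
    rewrite [leLHS](_ : _ = K * L * p ^+ (i + j) * p ^+ i * p ^+ j); last first.
      by rewrite exprD; ring.
    do 2 (apply: ler_wpM2r; first exact: exprn_ge0).
    apply: ler_wpM2l; first exact: mulr_ge0.
    by apply: ler_wiXn2l => //; [exact: ltW|lia].
  rewrite -mulr_sumr; apply: ler_wpM2l.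
    by rewrite !mulr_ge0// exprn_ge0.
  apply: le_trans (geo_sum_le n p01).
  rewrite [leRHS](@big_cat_nat _ _ _ (n - i))//= ?leq_subr// lerDr.
  by rewrite sumr_ge0// => k _; rewrite exprn_ge0.
rewrite -mulr_sumr [leRHS](_ : _ = K * L * (1 - p)^-1 * p ^+ n * (1 - p)^-1); last first.
  by rewrite /M; ring.
apply: ler_wpM2l; first by rewrite !mulr_ge0 ?exprn_ge0 ?invr_ge0 ?subr_ge0// ltW.
by rewrite -(big_mkord xpredT (fun k => p ^+ k)) geo_sum_le.
Qed.

End cauchy_product.

(** * Convergent power series: products and reciprocals *)

Section analytic.
Variable R : realType.
Implicit Types (f g : R -> R) (c d : R^nat) (r K h a s : R).

(** The body of [real_analytic] at a single point; the Kummer integral and [Gamma] are analytic only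
    at positive points. *)
Definition analytic_at f a0 : Prop :=
  exists2 r : R, 0 < r &
    exists c : R^nat, forall a : R, `|a - a0| < r ->
      series (fun k => c k * (a - a0) ^+ k) @ \oo --> f a.

Lemma analytic_at_congr f g a0 s : 0 < s ->
  (forall a, `|a - a0| < s -> f a = g a) -> analytic_at f a0 -> analytic_at g a0.
Proof.
move=> s0 fg [r r0 [c cf]]; exists (Num.min r s); first by rewrite lt_min r0.
by exists c => a; rewrite lt_min => /andP[ar as_]; rewrite -fg//; exact: cf.
Qed.

Lemma analytic_at_shift f a0 s : analytic_at f (a0 + s) ->
  analytic_at (fun a => f (a + s)) a0.
Proof.
move=> [r r0 [c cf]]; exists r => //; exists c => a ar.
have := cf (a + s); rewrite opprD addrACA subrr addr0; exact.
Qed.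

Lemma geometric_bound c h : h != 0 -> cvgn (series (fun k => c k * h ^+ k)) ->
  exists K, forall k, `|c k| * `|h| ^+ k <= K.
Proof.
move=> h0 /cvg_series_cvg_0 ch.
have /cvg_seq_bounded [M [_ HM]] : cvgn (fun k => c k * h ^+ k) by apply/cvg_ex; exists 0.
exists (M + 1) => k; have := HM (M + 1); rewrite ltrDl => /(_ ltr01 k I).
by rewrite /= normrM normrX.
Qed.

(** Convergence at the single point [a0 + r / 2] bounds the terms there, so geometric domination is
    obtained by halving the radius. *)
Lemma analytic_at_geometric f a0 : analytic_at f a0 ->
  exists r, exists c, exists K, [/\ 0 < r, forall k, `|c k| * r ^+ k <= K &
    forall a, `|a - a0| < r -> series (fun k => c k * (a - a0) ^+ k) @ \oo --> f a].
Proof.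
move=> [r r0 [c cf]].
have r20 : 0 < r / 2 by rewrite divr_gt0.
have r2r : r / 2 < r by rewrite ltr_pdivrMr// ltr_pMr// ltr1n.
have [| |K HK] := @geometric_bound c (r / 2); first exact: lt0r_neq0.
  apply/cvg_ex; exists (f (a0 + r / 2)).
  by have := cf (a0 + r / 2); rewrite addrAC subrr add0r gtr0_norm//; exact.
exists (r / 2), c, K; split=> //; first by move=> k; have := HK k; rewrite (gtr0_norm r20).
by move=> a ar; apply: cf; apply: lt_trans r2r.
Qed.

(** The radius [r / 4] is chosen because [1/4 = 1/2 * 1/2]: the bound takes the squared form that
    [cauchy_product] expects. *)
Lemma geometric_term c r K h k : 0 < r -> (forall k, `|c k| * r ^+ k <= K) ->
  `|h| < r / 4 -> `|c k * h ^+ k| <= K * (2^-1 ^+ k * 2^-1 ^+ k).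
Proof.
move=> r0 cK hr; rewrite -exprMn normrM normrX.
apply: (@le_trans _ _ (`|c k| * (r ^+ k * (2^-1 * 2^-1) ^+ k))); last first.
  by rewrite mulrA; apply: ler_wpM2r.
rewrite -exprMn; apply: ler_wpM2l => //; apply: lerXn2r; rewrite ?nnegrE//.
  by rewrite !mulr_ge0 ?invr_ge0// ltW.
by rewrite -invfM -natrM ltW.
Qed.

Lemma half01 : 0 <= (2^-1 : R) < 1.
Proof. by rewrite invr_ge0 ler0n/= invf_lt1// ltr1n. Qed.

Lemma geometric_cvg c r K h : 0 < r -> (forall k, `|c k| * r ^+ k <= K) ->
  `|h| < r / 4 -> cvgn (series (fun k => c k * h ^+ k)).
Proof.
move=> r0 cK hr; apply: normed_cvg.
apply: (@series_le_cvg _ _ (geometric K (2^-1 * 2^-1))).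
- by move=> n; rewrite normr_ge0.
- by move=> n; rewrite /geometric /= exprMn (le_trans _ (geometric_term n r0 cK hr)).
- by move=> n; rewrite /geometric /= exprMn (geometric_term n r0 cK hr).
- apply: is_cvg_geometric_series; rewrite -invfM -natrM ger0_norm ?invr_ge0//.
  by rewrite invf_lt1// ltr1n.
Qed.

Lemma convolutionX c d h :
  convolution (fun k => c k * h ^+ k) (fun k => d k * h ^+ k) =
  (fun k => convolution c d k * h ^+ k).
Proof.
apply/funext => n; rewrite /convolution mulr_suml; apply: eq_bigr => i _.
rewrite (_ : h ^+ n = h ^+ i * h ^+ (n - i)); last by rewrite -exprD subnKC// -ltnS.
by ring.
Qed.

Lemma cauchy_product_geometric c d r K L h (A B : R) : 0 < r ->
  (forall k, `|c k| * r ^+ k <= K) -> (forall k, `|d k| * r ^+ k <= L) ->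
  `|h| < r / 4 ->
  series (fun k => c k * h ^+ k) @ \oo --> A ->
  series (fun k => d k * h ^+ k) @ \oo --> B ->
  series (fun k => convolution c d k * h ^+ k) @ \oo --> A * B.
Proof.
move=> r0 cK dL hr cA dB; rewrite -convolutionX.
apply: (cauchy_product half01 _ _ cA dB) => k; [exact: (geometric_term k r0 cK hr)|
  exact: (geometric_term k r0 dL hr)].
Qed.

Lemma geometric_shrink c r s K : 0 <= s <= r -> (forall k, `|c k| * r ^+ k <= K) ->
  forall k, `|c k| * s ^+ k <= K.
Proof.
move=> /andP[s0 sr] cK k; apply: le_trans (cK k); apply: ler_wpM2l => //.
by apply: lerXn2r; rewrite ?nnegrE// (le_trans s0).
Qed.

Lemma analytic_atM f g a0 : analytic_at f a0 -> analytic_at g a0 ->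
  analytic_at (fun a => f a * g a) a0.
Proof.
move=> /analytic_at_geometric[r1 [c [K [r10 cK cf]]]].
move=> /analytic_at_geometric[r2 [d [L [r20 dL dg]]]].
pose r := Num.min r1 r2; have r0 : 0 < r by rewrite lt_min r10.
exists (r / 4); first by rewrite divr_gt0.
exists (convolution c d) => a ar.
have ar' : `|a - a0| < r.
  by rewrite (lt_le_trans ar)// ler_pdivrMr// ler_peMr// ?ler1n// ltW.
move: (ar'); rewrite lt_min => /andP[ar1 ar2].
apply: (@cauchy_product_geometric c d r K L) => //; [| |exact: cf|exact: dg].
- by apply: geometric_shrink cK; rewrite ltW//= ge_min lexx.
- by apply: geometric_shrink dL; rewrite ltW//= ge_min lexx orbT.
Qed.

Lemma analytic_atD f g a0 : analytic_at f a0 -> analytic_at g a0 ->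
  analytic_at (fun a => f a + g a) a0.
Proof.
move=> [r1 r10 [c cf]] [r2 r20 [d dg]].
exists (Num.min r1 r2); first by rewrite lt_min r10.
exists (fun k => c k + d k) => a; rewrite lt_min => /andP[ar1 ar2].
rewrite (_ : (fun k => _) =
    (fun k => c k * (a - a0) ^+ k) + (fun k => d k * (a - a0) ^+ k)).
  by rewrite seriesD; apply: cvgD; [exact: cf|exact: dg].
by apply/funext => k /=; rewrite mulrDl.
Qed.

Lemma analytic_at_affine (u v : R) a0 : analytic_at (fun a => u * a + v) a0.
Proof.
exists 1 => //; exists (fun k => if k == 0%N then u * a0 + v else if k == 1%N then u else 0).
move=> a _; rewrite -(cvg_shiftn 2); apply: cvg_near_cst; apply: nearW => n.
rewrite /= seriesEnat/= addn2 big_nat_recl// big_nat_recl//= big1 ?addr0; last first.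
  by move=> i _; rewrite mul0r.
by rewrite expr0 expr1; ring.
Qed.

(** Each coefficient of the formal reciprocal depends on all earlier ones, so the whole list up to
    [n] is carried along. *)
Fixpoint inverse_series_seq c n : seq R :=
  if n is m.+1 then
    let s := inverse_series_seq c m in
    rcons s (- (c 0%N)^-1 * \sum_(k < m.+1) c k.+1 * s`_(m - k))
  else [:: (c 0%N)^-1].

Definition inverse_series c : R^nat := fun n => (inverse_series_seq c n)`_n.

Lemma size_inverse_series_seq c n : size (inverse_series_seq c n) = n.+1.
Proof. by elim: n => //= n IH; rewrite size_rcons IH. Qed.

Lemma nth_inverse_series_seq c m n : (m <= n)%N ->
  (inverse_series_seq c n)`_m = inverse_series c m.
Proof.
elim: n => [|n IH]; first by rewrite leqn0 => /eqP ->.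
rewrite leq_eqVlt => /predU1P[->//|mn].
by rewrite [LHS]/= nth_rcons size_inverse_series_seq mn IH.
Qed.

Lemma inverse_seriesS c n : inverse_series c n.+1 =
  - (c 0%N)^-1 * \sum_(k < n.+1) c k.+1 * inverse_series c (n - k)%N.
Proof.
rewrite {1}/inverse_series /= nth_rcons size_inverse_series_seq ltnn eqxx.
congr (_ * _); apply: eq_bigr => k _.
by rewrite nth_inverse_series_seq// leq_subr.
Qed.

Lemma convolution_inverse c n : c 0%N != 0 ->
  convolution c (inverse_series c) n = (n == 0%N)%:R.
Proof.
move=> c0; case: n => [|n].
  by rewrite /convolution big_ord1 /inverse_series /= divff.
rewrite /convolution big_ord_recl subn0 inverse_seriesS mulNr mulrN mulVKf//.
by rewrite addrC; under eq_bigr do rewrite lift0 subSS; rewrite subrr.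
Qed.

(** Strong induction on the defining recurrence. The ratio [q] solves [K q / (1 - q) = |c 0|],
    exactly what makes the geometric sum reproduce the bound [1 / |c 0|]. *)
Lemma inverse_series_bound c r K : 0 < r -> c 0%N != 0 ->
  (forall k, `|c k| * r ^+ k <= K) ->
  let q := `|c 0%N| / (K + `|c 0%N|) in
  forall n, `|inverse_series c n| * (q * r) ^+ n <= `|c 0%N|^-1.
Proof.
move=> r0 c0 cK q n.
have C0 : 0 < `|c 0%N| by rewrite normr_gt0.
have K0 : 0 < K by have := cK 0%N; rewrite expr0 mulr1; exact: lt_le_trans.
have KC : 0 < K + `|c 0%N| by rewrite addr_gt0.
have q0 : 0 < q by rewrite divr_gt0.
have q1 : q < 1 by rewrite ltr_pdivrMr// mul1r ltrDr.
have qK : K * (q / (1 - q)) = `|c 0%N|.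
  by rewrite /q; field; rewrite addrK !lt0r_neq0.
have qr0 : 0 < q * r by rewrite mulr_gt0.
have [m] := ubnP n; elim: m n => // m IH [|n] nm.
  by rewrite expr0 mulr1 normfV.
rewrite inverse_seriesS normrM normrN normfV -mulrA ler_pdivrMl// divff ?lt0r_neq0//.
apply: (le_trans (ler_wpM2r _ (ler_norm_sum _ _ _))); first by rewrite exprn_ge0// ltW.
rewrite mulr_suml.
apply: (@le_trans _ _ (\sum_(k < n.+1) K * q ^+ k.+1 * `|c 0%N|^-1)).
  apply: ler_sum => k _; have kn : (k <= n)%N by rewrite -ltnS.
  rewrite normrM (_ : _ ^+ n.+1 = (q * r) ^+ k.+1 * (q * r) ^+ (n - k)); last first.
    by rewrite -exprD addSn subnKC.
  rewrite mulrACA; apply: ler_pM.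
  - by rewrite mulr_ge0// exprn_ge0// ltW.
  - by rewrite mulr_ge0// exprn_ge0// ltW.
  - by rewrite exprMn mulrCA mulrC; apply: ler_wpM2r; rewrite ?exprn_ge0// ltW.
  - by apply: IH; lia.
rewrite -mulr_suml ler_pdivrMr// mul1r -mulr_sumr -qK; apply: ler_wpM2l; first exact: ltW.
under eq_bigr do rewrite exprS.
rewrite -mulr_sumr; apply: ler_wpM2l; first exact: ltW.
by rewrite -(big_mkord xpredT (fun k => q ^+ k)) geo_sum_le// ltW.
Qed.

(** The formal reciprocal converges near [a0] to some [B], and the Cauchy product with the series of
    [f] is the constant 1. Hence [f a * B = 1], which shows both that [f] has no zero nearby and
    that [B] is its inverse. *)
Lemma analytic_atV f a0 : analytic_at f a0 -> f a0 != 0 ->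
  analytic_at (fun a => (f a)^-1) a0.
Proof.
move=> /analytic_at_geometric[r [c [K [r0 cK cf]]]] fa0.
have cfa0 : c 0%N = f a0.
  have := cf a0; rewrite subrr normr0 => /(_ r0) /cvg_lim <-//.
  apply/esym/cvg_lim => //; rewrite -(cvg_shiftn 1).
  apply: cvg_near_cst; apply: nearW => n.
  rewrite /= seriesEnat/= addn1 big_nat_recl// expr0 mulr1 big1 ?addr0// => i _.
  by rewrite expr0n mulr0.
have c0 : c 0%N != 0 by rewrite cfa0.
have dK := inverse_series_bound r0 c0 cK; move: dK => /=.
set q := _ / _ => dK.
have C0 : 0 < `|c 0%N| by rewrite normr_gt0.
have K0 : 0 < K by have := cK 0%N; rewrite expr0 mulr1; exact: lt_le_trans.
have q0 : 0 < q by rewrite divr_gt0// addr_gt0.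
have q1 : q < 1 by rewrite ltr_pdivrMr ?addr_gt0// mul1r ltrDr.
have qr0 : 0 < q * r by rewrite mulr_gt0.
have qrr : q * r <= r by rewrite ler_piMl// ltW.
exists (q * r / 4); first by rewrite divr_gt0.
exists (inverse_series c) => a ar.
have [B dB] : exists B : R, series (fun k => inverse_series c k * (a - a0) ^+ k) @ \oo --> B.
  by have /cvg_ex[B HB] := geometric_cvg qr0 dK ar; exists B.
have cfa : series (fun k => c k * (a - a0) ^+ k) @ \oo --> f a.
  apply: cf; apply: (lt_le_trans ar); apply: le_trans qrr.
  by rewrite ler_pdivrMr// ler_peMr// ?ler1n// ltW.
have cK' : forall k, `|c k| * (q * r) ^+ k <= K.
  by apply: geometric_shrink cK; rewrite ltW.
have := cauchy_product_geometric qr0 cK' dK ar cfa dB => /cvg_lim fB.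
suff fB1 : f a * B = 1.
  suff -> : (f a)^-1 = B by [].
  have fa : f a != 0 by apply: contra_eq_neq fB1 => ->; rewrite mul0r eq_sym oner_neq0.
  by apply: (mulfI fa); rewrite divff.
rewrite -fB//; apply/cvg_lim => //; rewrite -(cvg_shiftn 1).
apply: cvg_near_cst; apply: nearW => n.
rewrite /= seriesEnat/= addn1 big_nat_recl// convolution_inverse// expr0 mulr1.
by rewrite big1 ?addr0// => i _; rewrite convolution_inverse// mul0r.
Qed.

End analytic.

(** * Identity theorem, and continuation to the left by a two-term recursion *)

Section identity_theorem.
Variable R : realType.
Implicit Types (f g h : R -> R).

(** The series is assumed to vanish on one side of the centre only, which is all that is known at
    the left end of an interval of agreement. If [c j = 0] for [j < k], the first remaining term is
    controlled by the tail, hence [|c k| <= C t] for all small [t > 0]. *)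
Lemma power_series_zero (c : R^nat) (r K e : R) : 0 < r -> 0 < e ->
  (forall k, `|c k| * r ^+ k <= K) ->
  (forall t, 0 < t < e -> series (fun k => c k * t ^+ k) @ \oo --> (0 : R)) ->
  forall k, c k = 0.
Proof.
move=> r0 e0 cK ct k; have [m] := ubnP k; elim: m k => // m IH k km.
have {}IH j : (j < k)%N -> c j = 0 by move=> jk; apply: IH; lia.
have K0 : 0 <= K by have := cK 0%N; rewrite expr0 mulr1; exact: le_trans.
(* For [t <= r / 2] the tail is at most [2 K (t / r) ^ (k + 1)], the 2 being the sum of the
   geometric series of ratio 1/2; dividing by [t ^ (k + 1)] gives [C]. *)
pose C := 2 * K / r ^+ k.+1.
have C0 : 0 <= C by rewrite divr_ge0 ?mulr_ge0// exprn_ge0// ltW.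
have bnd t : 0 < t -> t < e -> t <= r / 2 -> `|c k| <= C * t.
  move=> t0 te tr; have te' : 0 < t < e by rewrite t0.
  have q0 : 0 <= t / r by rewrite divr_ge0// ltW.
  have q12 : t / r <= 2^-1 by rewrite ler_pdivrMr// mulrC.
  have q1 : 0 <= t / r < 1 by rewrite q0 (le_lt_trans q12)// invf_lt1// ltr1n.
  have H : `|series (fun j => c j * t ^+ j) n - c k * t ^+ k| @[n --> \oo] --> `|0 - c k * t ^+ k|.
    by apply: cvg_norm; apply: cvgB; [exact: ct|exact: cvg_cst].
  suff : `|c k * t ^+ k| <= C * t * t ^+ k.
    by have tk := exprn_gt0 k t0; rewrite normrM (gtr0_norm tk) ler_pM2r.
  rewrite -(normrN (c k * _)) -sub0r -(cvg_lim _ H)//.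
  apply: limr_le; first by apply/cvg_ex; eexists; exact: H.
  near=> n.
  have kn : (k < n)%N by near: n; exact: nbhs_infty_gt.
  rewrite seriesEnat/= (@big_cat_nat _ _ _ k)//=; last exact: ltnW.
  rewrite big_nat_cond big1 ?add0r; last first.
    by move=> j; rewrite andbT /= => jk; rewrite IH ?mul0r.
  rewrite big_ltn// addrAC subrr add0r.
  apply: (le_trans (ler_norm_sum _ _ _)).
  apply: (@le_trans _ _ (\sum_(k.+1 <= j < n) K * (t / r) ^+ j)).
    apply: ler_sum => j _; rewrite normrM normrX (gtr0_norm t0) expr_div_n.
    rewrite (_ : K * _ = K / r ^+ j * t ^+ j); last by ring.
    apply: ler_wpM2r; first by rewrite exprn_ge0// ltW.
    by rewrite ler_pdivlMr ?exprn_gt0.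
  rewrite -mulr_sumr (_ : C * t * _ = K * ((t / r) ^+ k.+1 * 2)); last first.
    by rewrite /C expr_div_n exprSr (exprSr t); field; rewrite expf_neq0 ?lt0r_neq0.
  apply: ler_wpM2l => //.
  rewrite -{1}(add0n k.+1) big_addn.
  under eq_bigr do rewrite addnC exprD.
  rewrite -mulr_sumr; apply: ler_wpM2l; first by rewrite exprn_ge0.
  apply: (le_trans (geo_sum_le _ q1)).
  by rewrite -[leRHS]invrK lef_pV2 ?posrE ?subr_gt0 ?invr_gt0//; lra.
apply/eqP; rewrite -normr_le0; apply/ler_addgt0Pl => d d0; rewrite addr0.
pose t := Num.min (Num.min (e / 2) (r / 2)) (d / (C + 1)).
have C1 : 0 < C + 1 by rewrite ltr_wpDl.
have t0 : 0 < t by rewrite !lt_min !divr_gt0.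
apply: (le_trans (bnd t t0 _ _)).
- by rewrite /t !gt_min (_ : e / 2 < e)// ltr_pdivrMr// ltr_pMr// ltr1n.
- by rewrite /t !ge_min lexx orbT.
- apply: (@le_trans _ _ ((C + 1) * (d / (C + 1)))).
    by apply: ler_pM => //; [exact: ltW|rewrite lerDl|rewrite /t ge_min lexx orbT].
  by rewrite mulrC divfK ?lt0r_neq0.
Unshelve. all: by end_near. Qed.

Lemma analytic_at_zero h a0 : analytic_at h a0 ->
  (forall a, a0 < a -> h a = 0) ->
  exists2 d : R, 0 < d & forall a, `|a - a0| < d -> h a = 0.
Proof.
move=> /analytic_at_geometric[r [c [K [r0 cK ch]]]] h0.
have c0 : forall k, c k = 0.
  apply: (@power_series_zero c r K r) => // t /andP[t0 tr].
  have := ch (a0 + t); rewrite h0 ?ltrDl//.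
  by rewrite addrAC subrr add0r gtr0_norm//; exact.
exists r => // a /ch /cvg_lim <-//; apply/cvg_lim => //.
rewrite (_ : series _ = cst 0); first exact: cvg_cst.
by apply/funext => n; rewrite seriesEnat/= big1// => i _; rewrite c0 mul0r.
Qed.

(** Let [S] be the set of [t] beyond which [f - g] vanishes. If the difference is nonzero at some
    [a1], then [S] is bounded below and contains its infimum; the power series there pushes the
    vanishing further left, a contradiction. *)
Lemma real_analytic_identity f g s : real_analytic f -> real_analytic g ->
  (forall a, s < a -> f a = g a) -> f = g.
Proof.
move=> fan gan fg; apply/funext => a1; apply: contrapT => fga1.
pose h a := f a + (-1) * g a.
have han a : analytic_at h a.
  apply: analytic_atD; first exact: fan.
  apply: analytic_atM; last exact: gan.
  apply: (@analytic_at_congr _ (fun x => 0 * x + -1) _ _ 1) => //.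
    by move=> b _; rewrite mul0r add0r.
  exact: analytic_at_affine.
have hE a : h a = 0 <-> f a = g a.
  by rewrite /h mulN1r; split => [/eqP|->]; rewrite ?subrr// subr_eq0 => /eqP.
pose S := [set t | forall a, t < a -> h a = 0].
have Ss : S s by move=> a /fg /hE.
have lbS : lbound S a1.
  by move=> t St; rewrite leNgt; apply/negP => /St /hE.
have Sinf : S (inf S).
  move=> a; rewrite -subr_gt0 => ha.
  have [|t St ta] := @inf_adherent _ S _ ha.
    by split; [exists s|exists a1].
  by apply: St; rewrite (lt_le_trans ta)// addrC subrK.
have [d d0 hd] := analytic_at_zero (han (inf S)) Sinf.
have : S (inf S - d / 2).
  move=> a ha; have [/Sinf//|aS] := ltP (inf S) a.
  apply: hd; rewrite ler0_norm ?subr_le0//.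
  by move: ha; have : d / 2 < d by [rewrite ltr_pdivrMr// ltr_pMr// ltr1n]; lra.
move=> /(ge_inf (_ : has_lbound S)) => /(_ (ex_intro _ a1 lbS)).
by apply/negP; rewrite -ltNge ltrBlDr ltrDl divr_gt0.
Qed.

(** The given [f] shows that [xget] does not return its default; the function it returns agrees with
    [f] on [a > 0], hence everywhere. *)
Lemma kummerUE (b x : R) f a : kummerU_continuation b x f -> kummerU a b x = f a.
Proof.
move=> fc; rewrite /kummerU; congr (_ a).
have [gan g0] : kummerU_continuation b x (xget (fun=> 0) [set f | kummerU_continuation b x f]).
  by apply: (@xgetPex _ (fun=> 0) [set f | kummerU_continuation b x f]); exists f.
have [fan f0] := fc.
by apply: (real_analytic_identity gan fan (s := 0)) => t t0; rewrite g0// f0.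
Qed.

Section extension.
Variables (u p q : R -> R).
Hypotheses (uan : forall a, 0 < a -> analytic_at u a).
Hypotheses (pan : forall a, analytic_at p a) (qan : forall a, analytic_at q a).
Hypothesis urec : forall a, 0 < a -> u a = p a * u (a + 1) + q a * u (a + 2).

(** Each unfolding of the recursion gains one unit to the left: level [n] is the continuation on
    [a > - n]. *)
Fixpoint left_extension n a : R :=
  if n is m.+1 then
    p a * left_extension m (a + 1) + q a * left_extension m (a + 2)
  else u a.

Lemma left_extensionS n a : - n%:R < a -> left_extension n.+1 a = left_extension n a.
Proof.
elim: n a => [|n IH] a; first by rewrite oppr0 => a0; rewrite /= -urec.
rewrite -natr1 => na.
have E m b : left_extension m.+1 b =
  p b * left_extension m (b + 1) + q b * left_extension m (b + 2) by [].
by rewrite E [RHS]E !IH//; lra.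
Qed.

Lemma left_extension_eq m n a : - n%:R < a -> (n <= m)%N ->
  left_extension m a = left_extension n a.
Proof.
move=> na; elim: m => [|m IH]; first by rewrite leqn0 => /eqP ->.
rewrite leq_eqVlt => /predU1P[->//|nm].
rewrite left_extensionS ?IH// (le_lt_trans _ na)// lerN2 ler_nat//.
Qed.

Lemma left_extension_analytic n a : - n%:R < a -> analytic_at (left_extension n) a.
Proof.
elim: n a => [|n IH] a; first by rewrite oppr0; exact: uan.
rewrite -natr1 => na /=; apply: analytic_atD; apply: analytic_atM => //.
  by apply: analytic_at_shift; apply: IH; lra.
by apply: analytic_at_shift; apply: IH; lra.
Qed.

(** The level varies with the point; by [left_extension_eq] any sufficient level gives the same
    value. *)
Definition analytic_extension a := left_extension (Num.bound `|a|) a.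

Lemma analytic_extensionE n a : - n%:R < a ->
  analytic_extension a = left_extension n a.
Proof.
move=> na; have ba : - (Num.bound `|a|)%:R < a.
  by rewrite ltrNl (le_lt_trans (ler_norm _))// normrN archi_boundP.
rewrite /analytic_extension; set m := Num.bound _ in ba *.
by rewrite -(left_extension_eq ba (leq_maxl m n)) -(left_extension_eq na (leq_maxr m n)).
Qed.

Lemma analytic_extension_analytic : real_analytic analytic_extension.
Proof.
(* One level more than the bound for [a], so that a fixed [n] serves every point within distance
   1. *)
move=> a; pose n := (Num.bound `|a|).+1.
have na : - n%:R < a - 1.
  by rewrite /n -natr1 opprD ltrD2r ltrNl (le_lt_trans (ler_norm _))// normrN archi_boundP.
apply: (@analytic_at_congr _ (left_extension n) _ _ 1) => //.
  move=> t; rewrite ltr_norml => /andP[t1 _]; rewrite (@analytic_extensionE n)//; lra.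
by apply: left_extension_analytic; lra.
Qed.

End extension.

End identity_theorem.

(** * Integrals over the half-line *)

Section half_line.
Variable R : realType.
Implicit Types (f g F G : R -> R).

Local Notation nu := (@lebesgue_measure R).
Local Notation D := (`]0, +oo[%classic : set R).

(** The shift by 2 gives [1/(n+2) < 1 < n+2], so that no interval degenerates to a point. *)
Definition exhaustion n : set R := `[n.+2%:R^-1, n.+2%:R].

Lemma half_lineE (t : R) : D t = (0 < t) :> Prop.
Proof. by rewrite /= in_itv/= andbT. Qed.

Lemma measurable_half_line : measurable D. Proof. exact: measurable_itv. Qed.

Lemma bigcup_exhaustion : \bigcup_n exhaustion n = D.
Proof.
apply/seteqP; split => t.
  move=> [n _]; rewrite /exhaustion half_lineE /= in_itv/= => /andP[nt _].
  by apply: lt_le_trans nt; rewrite invr_gt0.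
rewrite half_lineE => t0; pose n := maxn (Num.bound t) (Num.bound t^-1).
have bn u : (Num.bound u <= n)%N -> 0 <= u -> u <= n.+2%:R.
  move=> un u0; rewrite ltW// (lt_le_trans (archi_boundP u0))// ler_nat.
  by lia.
exists n => //; rewrite /exhaustion /= in_itv/=; apply/andP; split.
  by rewrite -[leRHS]invrK lef_pV2 ?posrE ?invr_gt0// bn ?leq_maxr// invr_ge0 ltW.
by rewrite bn ?leq_maxl// ltW.
Qed.

Lemma exhaustion_pos n t : exhaustion n t -> 0 < t.
Proof.
by rewrite /exhaustion /= in_itv/= => /andP[nt _]; apply: lt_le_trans nt; rewrite invr_gt0.
Qed.

Lemma exhaustion_homo : {homo exhaustion : n m / (n <= m)%N >-> (n <= m)%O}.
Proof.
move=> n m nm; apply/subsetPset => t; rewrite /exhaustion /= !in_itv/= => /andP[h1 h2].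
apply/andP; split; last by rewrite (le_trans h2)// ler_nat !ltnS.
by rewrite (le_trans _ h1)// lef_pV2 ?posrE// ler_nat !ltnS.
Qed.

Lemma continuous_half_line_within f a b : (forall t : R, 0 < t -> {for t, continuous f}) ->
  0 < a -> {within `[a, b], continuous f}.
Proof.
move=> cf a0; apply: continuous_in_subspaceT => t.
rewrite inE/= in_itv/= => /andP[at_ _]; apply: cf; exact: lt_le_trans at_.
Qed.

Lemma continuous_half_line_measurable f : (forall t : R, 0 < t -> {for t, continuous f}) ->
  measurable_fun D f.
Proof.
move=> cf; apply: open_continuous_measurable_fun; first exact: interval_open.
by move=> t; rewrite inE half_lineE; exact: cf.
Qed.

Lemma exhaustion_sub n : exhaustion n `<=` D.
Proof. by move=> t /exhaustion_pos; rewrite half_lineE. Qed.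

Lemma ge0_cvg_exhaustion f : measurable_fun D f -> (forall t : R, 0 < t -> 0 <= f t) ->
  (\int[nu]_(t in exhaustion n) (f t)%:E)%E @[n --> \oo] --> (\int[nu]_(t in D) (f t)%:E)%E.
Proof.
move=> mf f0; rewrite -bigcup_exhaustion.
apply: ge0_nondecreasing_set_cvg_integral.
- exact: exhaustion_homo.
- by move=> i; exact: measurable_itv.
- move=> i; apply/measurable_EFinP.
  by apply: measurable_funS mf; [exact: measurable_itv|exact: exhaustion_sub].
- by move=> i t /exhaustion_pos t0; rewrite lee_fin f0.
Qed.

Lemma integrable_cvg_exhaustion f : nu.-integrable D (EFin \o f) ->
  (\int[nu]_(t in exhaustion n) (f t)%:E)%E @[n --> \oo] --> (\int[nu]_(t in D) (f t)%:E)%E.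
Proof.
move=> fi; have mf := measurable_int _ fi.
pose g n := (EFin \o f) \_ (exhaustion n).
rewrite (_ : (fun n => _) = (fun n => \int[nu]_(t in D) g n t)%E); last first.
  apply/funext => n; rewrite -integral_mkcondr; congr (integral _ _ _).
  by apply/esym/setIidr; exact: exhaustion_sub.
have [] := @dominated_convergence _ _ R nu D measurable_half_line g (EFin \o f)
  (fun t => `|(f t)%:E|%E) => //.
- move=> n; apply/measurable_restrict => //; first exact: measurable_itv.
  by apply: measurable_funS mf => //; exact: subIsetr.
- apply: aeW => t; rewrite half_lineE => t0.
  have : (\bigcup_n exhaustion n) t by rewrite bigcup_exhaustion half_lineE.
  move=> [N _ Nt]; apply: cvg_near_cst; near=> n.
  rewrite /g patchE mem_set//.
  have Nn : (N <= n)%N by near: n; exact: nbhs_infty_ge.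
  by have /subsetPset := exhaustion_homo Nn; exact.
- exact: integrable_abse.
- apply: aeW => t n _; rewrite /g patchE; case: ifPn => // _.
  by rewrite abse0 abse_ge0.
Unshelve. all: by end_near. Qed.

Section FTC.
Variables (f F : R -> R).
Hypothesis cf : forall t : R, 0 < t -> {for t, continuous f}.
Hypothesis dF : forall t : R, 0 < t -> is_derive t (1 : R) F (f t).

Lemma FTC_half_line a b : 0 < a -> a < b ->
  (\int[nu]_(t in `[a, b]) (f t)%:E = (F b - F a)%:E)%E.
Proof.
move=> a0 ab; have b0 := lt_trans a0 ab.
have cF (t : R) : 0 < t -> {for t, continuous F}.
  move=> t0; apply: differentiable_continuous; apply/derivable1_diffP.
  by have := dF t0 => -[].
rewrite (@continuous_FTC2 _ f F)//.
- exact: continuous_half_line_within.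
- split.
  + move=> t; rewrite in_itv/= => /andP[at_ _].
    by have := dF (lt_trans a0 at_) => -[].
  + by apply: cvg_at_right_filter; exact: cF.
  + by apply: cvg_at_left_filter; exact: cF.
- move=> t; rewrite in_itv/= => /andP[at_ _]; rewrite derive1E.
  by have := dF (lt_trans a0 at_) => -[].
Qed.

Lemma FTC_exhaustion n :
  (\int[nu]_(t in exhaustion n) (f t)%:E = (F n.+2%:R - F n.+2%:R^-1)%:E)%E.
Proof.
apply: FTC_half_line; first by rewrite invr_gt0.
by rewrite (@lt_trans _ _ 1)// ?ltr1n// invf_lt1// ltr1n.
Qed.

(** Boundedness of a nonnegative antiderivative bounds the improper integral, by monotone
    convergence along the exhaustion. *)
Lemma integral_derivative_le (M : R) :
  (forall t : R, 0 < t -> 0 <= f t) -> (forall t : R, 0 < t -> 0 <= F t <= M) ->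
  (\int[nu]_(t in D) (f t)%:E <= M%:E)%E.
Proof.
move=> f0 FM.
have H := ge0_cvg_exhaustion (continuous_half_line_measurable cf) f0.
rewrite -(cvg_lim _ H)//; apply: lime_le; first by apply/cvg_ex; eexists; exact: H.
apply: nearW => n; rewrite FTC_exhaustion lee_fin.
have /andP[_ h1] : 0 <= F n.+2%:R <= M by apply: FM.
have /andP[h2 _] : 0 <= F n.+2%:R^-1 <= M by apply: FM; rewrite invr_gt0.
by rewrite (le_trans _ h1)// gerBl.
Qed.

Lemma integral_derivative0 : nu.-integrable D (EFin \o f) ->
  F t @[t --> 0^'+] --> (0 : R) -> F t @[t --> +oo] --> (0 : R) ->
  \int[nu]_(t in D) f t = 0.
Proof.
move=> fi F0 Fy; have H := integrable_cvg_exhaustion fi.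
rewrite /Rintegral -(cvg_lim _ H)// (_ : lim _ = 0%E)//; apply/cvg_lim => //.
under eq_fun do rewrite FTC_exhaustion.
rewrite -[0%E]/((0 : R)%:E); apply: cvg_EFin; first exact: nearW.
rewrite [X in X @ _ --> _](_ : _ = fun n => F n.+2%:R - F n.+2%:R^-1)//.
have ny : (n.+2%:R : R) @[n --> \oo] --> +oo.
  rewrite (_ : (fun n => _) = (fun n => (n + 2)%N%:R : R)); last first.
    by apply/funext => n; rewrite addn2.
  by rewrite (cvg_shiftn 2 (fun n => n%:R : R)); exact: cvgr_idn.
rewrite -[X in _ --> X](subr0 (0 : R)); apply: cvgB.
  by move/cvg_pinftyP : Fy; apply.
move/cvg_at_rightP : F0; apply; split; first by move=> n; rewrite invr_gt0.
by apply/gtr0_cvgV0 => //; exact: nearW.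
Qed.

End FTC.
End half_line.

Section substitution.
Variable R : realType.
Implicit Types (f g F G : R -> R).

Local Notation nu := (@lebesgue_measure R).
Local Notation D := (`]0, +oo[%classic : set R).

Lemma is_derive_power (s : R) p (x : R) :
  is_derive x 1 (fun x => s * x ^+ p) (s * (p%:R * x ^+ p.-1)).
Proof.
rewrite (_ : (fun x => _) = s \*: (id ^+ p : R -> R)).
  by apply: is_derive_eq; rewrite /GRing.scale /= mulr1.
by apply/funext => y; rewrite /GRing.scale /= exprfctE.
Qed.

(** Substitution holds on each compact interval of the exhaustion. Its images under [F] exhaust the
    half-line too, and monotone convergence passes to the limit on both sides. *)
Lemma integral_substitution_power (G : R -> R) (s : R) (p : nat) : 0 < s -> (0 < p)%N ->
  (forall t : R, 0 < t -> {for t, continuous G}) -> (forall t : R, 0 < t -> 0 <= G t) ->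
  (\int[nu]_(t in D) (G t)%:E =
   \int[nu]_(x in D) (G (s * x ^+ p) * (s * (p%:R * x ^+ p.-1)))%:E)%E.
Proof.
move=> s0 p0 cG G0; pose F (x : R) := s * x ^+ p.
have Fpos x : 0 < x -> 0 < F x by move=> x0; rewrite mulr_gt0// exprn_gt0.
have Fhomo (x y : R) : 0 <= x -> x < y -> F x < F y.
  by move=> x0 xy; rewrite ltr_pM2l// ltrXn2r// -lt0n.
have dF (x : R) : is_derive x 1 F (s * (p%:R * x ^+ p.-1)) := is_derive_power s p x.
have cF : continuous F.
  move=> x; apply: differentiable_continuous; apply/derivable1_diffP.
  by have := dF x => -[].
have F'E : derive1 F = (fun x => s * (p%:R * x ^+ p.-1)).
  by apply/funext => x; rewrite derive1E; have := dF x => -[].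
have cF' : continuous (derive1 F).
  rewrite F'E => x; apply: cvgM; first exact: cvg_cst.
  by apply: cvgM; [exact: cvg_cst|exact: exprn_continuous].
pose E n : set R := [set` `[F n.+2%:R^-1, F n.+2%:R]].
have Fle (x y : R) : 0 <= x -> x <= y -> F x <= F y.
  by move=> x0; rewrite le_eqVlt => /predU1P[->//|/(Fhomo _ _ x0) /ltW].
have EU : \bigcup_n E n = D.
  apply/seteqP; split => t.
    move=> [n _]; rewrite /E half_lineE /= in_itv/= => /andP[nt _].
    by apply: lt_le_trans nt; apply: Fpos; rewrite invr_gt0.
  (* Since [1/(n+2) <= 1 <= n+2], the [p]-th power is below its argument at the left end and above
     it at the right end, so comparing with [s/(n+2)] and [s(n+2)] is enough. *)
  rewrite half_lineE => t0; pose n := maxn (Num.bound (t / s)) (Num.bound (s / t)).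
  have bn u : (Num.bound u <= n)%N -> 0 <= u -> u <= n.+2%:R.
    move=> un u0; rewrite ltW// (lt_le_trans (archi_boundP u0))// ler_nat.
    by lia.
  exists n => //; rewrite /E /= in_itv/= /F; apply/andP; split.
    apply: (@le_trans _ _ (s * n.+2%:R^-1)).
      rewrite ler_pM2l// ler_iXnr// ?invr_ge0//=.
      by rewrite invf_le1// ler1n.
    rewrite ler_pdivrMr// mulrC -ler_pdivrMr//.
    by rewrite bn ?leq_maxr// divr_ge0// ltW.
  apply: (@le_trans _ _ (s * n.+2%:R)).
    rewrite -ler_pdivrMl// mulrC.
    by rewrite bn ?leq_maxl// divr_ge0// ltW.
  by rewrite ler_pM2l// ler_eXnr// ler1n.
have EH : {homo E : n m / (n <= m)%N >-> (n <= m)%O}.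
  move=> n m nm; apply/subsetPset => t; rewrite /E /= !in_itv/= => /andP[h1 h2].
  apply/andP; split; last by rewrite (le_trans h2)// Fle// ler_nat !ltnS.
  by rewrite (le_trans _ h1)// Fle ?invr_ge0// lef_pV2 ?posrE// ler_nat !ltnS.
have H1 : (\int[nu]_(t in E n) (G t)%:E)%E @[n --> \oo] --> (\int[nu]_(t in D) (G t)%:E)%E.
  rewrite -EU; apply: ge0_nondecreasing_set_cvg_integral => //.
  - by move=> i; exact: measurable_itv.
  - move=> i; apply/measurable_EFinP; apply: (@measurable_funS _ _ _ _ D).
    + exact: measurable_half_line.
    + by rewrite -EU; exact: bigcup_sup.
    + exact: continuous_half_line_measurable.
  - move=> i t Et; rewrite lee_fin G0//.
    by have : D t; [rewrite -EU; exists i|rewrite half_lineE].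
have H2 : (\int[nu]_(x in exhaustion n) (G (F x) * derive1 F x)%:E)%E @[n --> \oo] -->
     (\int[nu]_(x in D) (G (F x) * derive1 F x)%:E)%E.
  apply: ge0_cvg_exhaustion.
    apply: continuous_half_line_measurable => t t0; apply: cvgM; last exact: cF'.
    by apply: continuous_comp; [exact: cF|apply: cG; exact: Fpos].
  move=> t t0; rewrite mulr_ge0 ?G0 ?Fpos//.
  by rewrite F'E mulr_ge0 ?(ltW s0)// mulr_ge0 ?exprn_ge0 ?(ltW t0).
rewrite F'E in H2.
rewrite -(cvg_lim _ H1)// -(cvg_lim _ H2)//.
rewrite (_ : (fun n => _) = (fun n => \int[nu]_(x in exhaustion n)
  (G (F x) * (s * (p%:R * x ^+ p.-1)))%:E)%E)//; apply/funext => n.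
have n0 : 0 < n.+2%:R^-1 :> R by rewrite invr_gt0.
have nn : n.+2%:R^-1 <= n.+2%:R :> R.
  by rewrite (@le_trans _ _ 1)// ?ler1n// invf_le1// ler1n.
rewrite /E integration_by_substitution_increasing//.
- by rewrite F'E.
- move=> x y; rewrite !in_itv/= => /andP[x0 _] _; apply: Fhomo.
  by rewrite (le_trans _ x0)// ltW.
- exact: (cvgP _ (cvg_at_right_filter (cF' _))).
- exact: (cvgP _ (cvg_at_left_filter (cF' _))).
- split; first by move=> x _; have := dF x => -[].
    by apply: cvg_at_right_filter; exact: cF.
  by apply: cvg_at_left_filter; exact: cF.
- by apply: continuous_half_line_within => //; exact: Fpos.
Qed.

End substitution.

(** * The kernel common to the Gamma, Beta and Kummer integrals *)

Section kappa.
Variable R : realType.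
Implicit Types (p q x t a b c : R).

Local Notation nu := (@lebesgue_measure R).
Local Notation D := (`]0, +oo[%classic : set R).

(** Gamma is the case [q = 0], [x = 1], Beta the case [x = 0], and the Kummer integral has
    [p = a - 1], [q = b - a - 1]. On the half-line, derivatives of kernels are combinations of
    kernels. *)
Definition kappa p q x t : R := t `^ p * (t + 1) `^ q * expR (- (t * x)).

Lemma kappa_ge0 p q x t : 0 <= kappa p q x t.
Proof. by rewrite /kappa !mulr_ge0 ?powR_ge0 ?expR_ge0. Qed.

Lemma is_derive_kappa p q x t : 0 < t ->
  is_derive t (1 : R) (kappa p q x)
    (p * kappa (p - 1) q x t + q * kappa p (q - 1) x t - x * kappa p q x t).
Proof.
move=> t0; have t1 : 0 < t + 1 by rewrite addr_gt0.
have d1 := is_derive1_powR p t0.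
have d2 : is_derive t (1 : R) (fun t => (t + 1) `^ q) (q * (t + 1) `^ (q - 1)).
  rewrite -[X in is_derive _ _ _ X]mulr1.
  apply: (@is_derive1_comp _ (fun u => u `^ q) (fun t => t + 1)).
    exact: is_derive1_powR.
  by rewrite -[X in is_derive _ _ _ X]addr0; exact: is_deriveD.
have d3 : is_derive t (1 : R) (fun t => expR (- (t * x))) (expR (- (t * x)) * - x).
  apply: (@is_derive1_comp _ expR (fun t => - (t * x))).
  have h : is_derive t (1 : R) (fun t => t * x) x.
    rewrite (_ : (fun t => t * x) = (x \*: id)).
      by rewrite -[X in is_derive _ _ _ X]mulr1; exact: is_deriveZ.
    by apply/funext => u; rewrite /= mulrC.
  exact: is_deriveN.
have d : is_derive t (1 : R) (kappa p q x) _ := is_deriveM (is_deriveM d1 d2) d3.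
apply: (is_derive_eq d); rewrite /GRing.scale mulrfctE /= /kappa; ring.
Qed.

Lemma kappa_continuous p q x t : 0 < t -> {for t, continuous (kappa p q x)}.
Proof.
move=> t0; apply: differentiable_continuous; apply/derivable1_diffP.
by have := is_derive_kappa p q x t0 => -[].
Qed.

Lemma measurable_kappa p q x : measurable_fun setT (kappa p q x).
Proof.
apply: measurable_funM; first apply: measurable_funM.
- exact: measurable_powR.
- by apply: (measurableT_comp (measurable_powR q)); exact: measurable_funD.
- by apply: (measurableT_comp (@measurable_expR R)); apply: measurable_funN; exact: measurable_funM.
Qed.

Lemma kappaSl p q x t : 0 < t -> kappa (p + 1) q x t = t * kappa p q x t.
Proof.
move=> t0; rewrite /kappa powRD ?powRr1 ?ltW//; first by ring.
by rewrite (lt0r_neq0 t0) implybT.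
Qed.

Lemma kappaSr p q x t : 0 < t -> kappa p (q + 1) x t = (t + 1) * kappa p q x t.
Proof.
move=> t0; have t1 : 0 < t + 1 by rewrite addr_gt0.
rewrite /kappa powRD ?powRr1 ?(ltW t1)//; first by ring.
by rewrite (lt0r_neq0 t1) implybT.
Qed.

Lemma kappa_split p q x t : 0 < t ->
  kappa p (q + 1) x t = kappa (p + 1) q x t + kappa p q x t.
Proof. by move=> t0; rewrite kappaSr// kappaSl// mulrDl mul1r. Qed.

(** For [q > 0], the inequality [y <= exp y] at [y = (t + 1) x / q], raised to the power [q], bounds
    [(t + 1) ^ q] by a constant times [exp ((t + 1) x)]. *)
Lemma powR_expR_bounded q x : 0 < x ->
  exists2 C, 0 <= C & forall t, 0 < t -> (t + 1) `^ q * expR (- (t * x)) <= C.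
Proof.
move=> x0; have [q0|q0] := leP q 0.
  exists 1 => // t t0; rewrite -[leRHS]mulr1; apply: ler_pM; rewrite ?powR_ge0 ?expR_ge0//.
    by rewrite -[leRHS](powRr0 (t + 1)) ler_powR// lerDr ltW.
  by rewrite -expR0 ler_expR oppr_le0 mulr_ge0// ltW.
exists ((q / x) `^ q * expR x); first by rewrite mulr_ge0 ?powR_ge0 ?expR_ge0.
move=> t t0; have t1 : 0 < t + 1 by rewrite addr_gt0.
have qx : 0 < q / x by rewrite divr_gt0.
have h : (t + 1) <= (q / x) * expR ((t + 1) * x / q).
  rewrite -ler_pdivrMl// invf_div (le_trans _ (expR_ge1Dx _))// ler_wpDl//.
  by rewrite mulrC mulrA.
have : (t + 1) `^ q <= (q / x) `^ q * expR ((t + 1) * x).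
  apply: (@le_trans _ _ (((q / x) * expR ((t + 1) * x / q)) `^ q)).
    by apply: ge0_ler_powR; rewrite ?nnegrE ?(ltW q0) ?(ltW t1)// mulr_ge0 ?expR_ge0// ltW.
  by rewrite powRM ?expR_ge0 ?(ltW qx)// -expRM divfK// lt0r_neq0.
move=> h2; rewrite -[leRHS]mulr1 -{2}expR0 -(subrr (t * x)) expRD mulrA.
apply: ler_wpM2r; first exact: expR_ge0.
by rewrite -mulrA -expRD (le_trans h2)// mulrDl mul1r addrC.
Qed.

(** An antiderivative is [(t / (t + 1)) ^ a / a], which stays between 0 and [1 / a]. *)
Lemma integral_beta_kernel a : 0 < a ->
  (\int[nu]_(t in D) (kappa (a - 1) (- a - 1) 0 t)%:E < +oo)%E.
Proof.
move=> a0.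
apply: (@le_lt_trans _ _ (a^-1)%:E); last exact: ltry.
apply: (@integral_derivative_le _ _ (fun t => a^-1 * kappa a (- a) 0 t)).
- by move=> t t0; exact: kappa_continuous.
- move=> t t0.
  have d : is_derive t (1 : R) (fun t => a^-1 * kappa a (- a) 0 t) _ :=
    @is_deriveZ _ _ _ _ a^-1 _ _ _ (is_derive_kappa a (- a) 0 t0).
  apply: (is_derive_eq d).
  have e1 : kappa a (- a - 1) 0 t = t * kappa (a - 1) (- a - 1) 0 t.
    by rewrite -kappaSl// subrK.
  have e2 : kappa (a - 1) (- a) 0 t = (t + 1) * kappa (a - 1) (- a - 1) 0 t.
    by rewrite -kappaSr// subrK.
  rewrite e1 e2 /GRing.scale/=.
  by field; exact: lt0r_neq0.
- by move=> t t0; exact: kappa_ge0.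
- move=> t t0; rewrite mulr_ge0 ?kappa_ge0 ?invr_ge0 ?(ltW a0)//=.
  rewrite ler_piMr ?invr_ge0 ?(ltW a0)// /kappa mulr0 oppr0 expR0 mulr1.
  rewrite powRN ler_pdivrMr ?powR_gt0 ?addr_gt0// mul1r.
  apply: ge0_ler_powR; rewrite ?nnegrE ?lerDl//; [exact: ltW|exact: ltW|by rewrite addr_ge0// ltW].
Qed.

(** Comparison with the Beta kernel [t ^ p (t + 1) ^ (- p - 2)], integrable at both ends; the
    quotient [(t + 1) ^ (q + p + 2) exp (- t x)] is bounded. *)
Lemma kappa_integrable p q x : -1 < p -> 0 < x -> nu.-integrable D (EFin \o kappa p q x).
Proof.
move=> p1 x0.
have a0 : 0 < p + 1 by rewrite -ltrBlDr sub0r.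
have [C C0 HC] := powR_expR_bounded (q + p + 1 + 1) x0.
have := integral_beta_kernel a0; rewrite addrK => base.
apply: (@le_integrable _ _ _ nu D _ _ (fun t => (C * kappa p (- (p + 1) - 1) 0 t)%:E)) => //.
- by apply/measurable_EFinP; apply: measurable_funTS; exact: measurable_kappa.
- move=> t; rewrite half_lineE => t0 /=.
  have t1 : 0 < t + 1 by rewrite addr_gt0.
  rewrite lee_fin (ger0_norm (kappa_ge0 _ _ _ _)) (ger0_norm (mulr_ge0 C0 (kappa_ge0 _ _ _ _))).
  rewrite /kappa mulr0 oppr0 expR0 mulr1 -[leLHS]mulrA [leRHS]mulrCA; apply: ler_wpM2l; first exact: powR_ge0.
  rewrite -ler_pdivrMr ?powR_gt0// -powRN mulrAC -powRD ?(lt0r_neq0 t1) ?implybT//.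
  rewrite (_ : q - _ = q + p + 1 + 1); last by ring.
  exact: HC.
- apply/integrableP; split.
    by apply/measurable_EFinP; apply: measurable_funM => //; apply: measurable_funTS; exact: measurable_kappa.
  under eq_integral do rewrite (gee0_abs (_ : 0 <= _)%E) ?lee_fin ?(mulr_ge0 C0 (kappa_ge0 _ _ _ _))// EFinM.
  rewrite ge0_integralZl//; last 2 first.
  + by apply/measurable_EFinP; apply: measurable_funTS; exact: measurable_kappa.
  + by move=> t _; rewrite lee_fin kappa_ge0.
  by rewrite lte_mul_pinfty.
Qed.

Definition Kappa p q x := \int[nu]_(t in D) kappa p q x t.

Lemma kappa_cvg0 a q x : 0 < a -> 0 < x -> kappa a q x t @[t --> 0^'+] --> (0 : R).
Proof.
move=> a0 x0; have [C C0 HC] := powR_expR_bounded q x0.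
apply: (@squeeze_cvgr _ _ _ _ (cst 0) (fun t => t `^ a * C)).
- near=> t; rewrite kappa_ge0/= /kappa -mulrA ler_wpM2l ?powR_ge0// HC//.
- exact: cvg_cst.
- rewrite -[X in _ --> X](mul0r C); apply: cvgM; last exact: cvg_cst.
  exact: powR_cvg0.
Unshelve. all: by end_near. Qed.

Lemma kappa_cvgy a q x : 0 <= a -> 0 < x -> kappa a q x t @[t --> +oo] --> (0 : R).
Proof.
move=> a0 x0; have [C C0 HC] := powR_expR_bounded (a + q + 1) x0.
apply: (@squeeze_cvgr _ _ _ _ (cst 0) (fun t => t^-1 * C)).
- near=> t; have t0 : 0 < t by near: t; exact: nbhs_pinfty_gt.
  have t1 : 0 < t + 1 by rewrite addr_gt0.
  rewrite kappa_ge0/= ler_pdivlMl// (le_trans _ (HC t t0))//.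
  rewrite powRD ?(lt0r_neq0 t1) ?implybT// powRr1 ?(ltW t1)//.
  rewrite powRD ?(lt0r_neq0 t1) ?implybT// /kappa.
  rewrite [leLHS](_ : _ = t `^ a * (t + 1) `^ q * t * expR (- (t * x))); last by ring.
  apply: ler_wpM2r; first exact: expR_ge0.
  apply: ler_pM; rewrite ?mulr_ge0 ?powR_ge0 ?(ltW t0)// ?lerDl//.
  apply: ler_wpM2r; first exact: powR_ge0.
  by apply: ge0_ler_powR; rewrite ?nnegrE ?(ltW t0) ?(ltW t1)// lerDl.
- exact: cvg_cst.
- rewrite -[X in _ --> X](mul0r C); apply: cvgM; last exact: cvg_cst.
  by apply/gtr0_cvgV0; [near=> t; near: t; exact: nbhs_pinfty_gt|].
Unshelve. all: by end_near. Qed.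

Lemma integrable_scale (E : set R) (f : R -> R) k : measurable E ->
  nu.-integrable E (EFin \o f) -> nu.-integrable E (EFin \o (fun t => k * f t)).
Proof.
move=> mE fi; rewrite (_ : _ \o _ = (fun t => k%:E * (EFin \o f) t)%E); last first.
  by apply/funext => t; rewrite /= EFinM.
exact: integrableZl.
Qed.

Lemma integrable_add (E : set R) (f g : R -> R) : measurable E ->
  nu.-integrable E (EFin \o f) -> nu.-integrable E (EFin \o g) ->
  nu.-integrable E (EFin \o (fun t => f t + g t)).
Proof.
move=> mE fi gi; rewrite (_ : _ \o _ = ((EFin \o f) \+ (EFin \o g))%E).
  exact: integrableD.
by apply/funext => t; rewrite /= EFinD.
Qed.

(** The derivative of [kappa a q x] integrates to zero because the kernel tends to 0 at both ends.
    For [q = 0] and [x = 1] this is the functional equation of [Gamma]. *)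
Lemma Kappa_rec a q x : 0 < a -> 0 < x ->
  a * Kappa (a - 1) q x + q * Kappa a (q - 1) x = x * Kappa a q x.
Proof.
move=> a0 x0; apply/eqP; rewrite -subr_eq0 -mulNr; apply/eqP.
have i1 : nu.-integrable D (EFin \o kappa (a - 1) q x) by apply: kappa_integrable => //; lra.
have i2 : nu.-integrable D (EFin \o kappa a (q - 1) x) by apply: kappa_integrable => //; lra.
have i3 : nu.-integrable D (EFin \o kappa a q x) by apply: kappa_integrable => //; lra.
have j1 : nu.-integrable D (EFin \o (fun t => a * kappa (a - 1) q x t)).
  exact: integrable_scale.
have j2 : nu.-integrable D (EFin \o (fun t => q * kappa a (q - 1) x t)).
  exact: integrable_scale.
have j3 : nu.-integrable D (EFin \o (fun t => - x * kappa a q x t)).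
  exact: integrable_scale.
have j12 : nu.-integrable D (EFin \o (fun t => a * kappa (a - 1) q x t + q * kappa a (q - 1) x t)).
  exact: integrable_add.
rewrite -!RintegralZl// -RintegralD// -RintegralD//.
apply: (@integral_derivative0 _ _ (kappa a q x)).
- move=> t t0; apply: cvgD; first apply: cvgD.
  + by apply: cvgM; [exact: cvg_cst|exact: kappa_continuous].
  + by apply: cvgM; [exact: cvg_cst|exact: kappa_continuous].
  + by apply: cvgM; [exact: cvg_cst|exact: kappa_continuous].
- by move=> t t0; rewrite mulNr; exact: is_derive_kappa.
- exact: integrable_add.
- exact: kappa_cvg0.
- by apply: kappa_cvgy => //; exact: ltW.
Qed.

End kappa.

Section gamma.
Variable R : realType.
Implicit Types (p q x t a b c : R).

Local Notation nu := (@lebesgue_measure R).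
Local Notation D := (`]0, +oo[%classic : set R).

Lemma GammaE a : Gamma a = Kappa (a - 1) 0 1.
Proof.
apply: eq_Rintegral => t; rewrite inE half_lineE => t0.
by rewrite /kappa powRr0 !mulr1.
Qed.

Lemma Gamma_rec a : 0 < a -> Gamma (a + 1) = a * Gamma a.
Proof.
move=> a0; rewrite !GammaE addrK; have := @Kappa_rec R a 0 1 a0 ltr01.
by rewrite mul0r addr0 mul1r.
Qed.

Lemma Kappa_ge0 p q x : 0 <= Kappa p q x.
Proof. by apply: Rintegral_ge0 => t _; exact: kappa_ge0. Qed.

Lemma KappaE p q x : -1 < p -> 0 < x ->
  (\int[nu]_(t in D) (kappa p q x t)%:E = (Kappa p q x)%:E)%E.
Proof.
move=> p1 x0; rewrite /Kappa /Rintegral fineK//.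
by apply: integrable_fin_num => //; exact: kappa_integrable.
Qed.

(** A zero integral would force the kernel to vanish almost everywhere on the half-line, where it is
    positive and whose measure is infinite. *)
Lemma Kappa_gt0 p q x : -1 < p -> 0 < x -> 0 < Kappa p q x.
Proof.
move=> p1 x0; rewrite lt_def Kappa_ge0 andbT; apply/eqP => K0.
have := KappaE q p1 x0; rewrite K0 => I0.
have mk : measurable_fun D (EFin \o kappa p q x).
  by apply/measurable_EFinP; apply: measurable_funTS; exact: measurable_kappa.
have [+ _] := @ae_eq_integral_abs _ _ R nu D (@measurable_half_line R) _ mk.
under eq_integral do rewrite gee0_abs ?lee_fin ?kappa_ge0//.
move=> /(_ I0) [N [mN N0 DN]].
have : (nu D <= 0)%E.
  rewrite -N0; apply: le_measure; rewrite ?inE; [exact: measurable_half_line|exact: mN|].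
  move=> t Dt; apply: DN => /= /(_ Dt) [] /eqP; apply/negP.
  rewrite half_lineE in Dt.
  rewrite lt0r_neq0// !mulr_gt0 ?powR_gt0 ?expR_gt0// addr_gt0//.
apply/negP; rewrite -ltNge lebesgue_measure_itv/= ltry.
by rewrite addye// oppe0.
Qed.

Lemma Gamma_gt0 a : 0 < a -> 0 < Gamma a.
Proof. by move=> a0; rewrite GammaE Kappa_gt0//; lra. Qed.

(** Substitution [u = s x ^ m] in the integral of [Gamma c]. It serves with [m = 1] for the Beta
    integral and with [m = 3] for the weights. *)
Lemma Gamma_power_integral (m : nat) (s c : R) : (0 < m)%N -> 0 < s -> 0 < c ->
  (\int[nu]_(x in D) (x `^ (m%:R * c - 1) * expR (- (s * x ^+ m)))%:E =
   (s `^ (- c) * Gamma c / m%:R)%:E)%E.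
Proof.
move=> m0 s0 c0.
have c1 : -1 < c - 1 by lra.
have mR : 0 < m%:R :> R by rewrite ltr0n.
have := @integral_substitution_power R (kappa (c - 1) 0 1) s m s0 m0
  (fun u hu => @kappa_continuous R _ _ _ u hu) (fun t _ => kappa_ge0 _ _ _ t).
rewrite KappaE// -GammaE.
rewrite (_ : (\int[nu]_(x in D) _ = \int[nu]_(x in D) ((s `^ c * m%:R)%:E *
  (x `^ (m%:R * c - 1) * expR (- (s * x ^+ m)))%:E))%E); last first.
  apply: eq_integral => x; rewrite inE half_lineE => x0.
  rewrite -EFinM; congr (_%:E).
  rewrite /kappa powRr0 !mulr1 powRM ?(ltW s0) ?exprn_ge0 ?(ltW x0)//.
  rewrite -powR_mulrn ?(ltW x0)// -powRrM.
  rewrite (_ : x ^+ m.-1 = x `^ (m%:R - 1)); last first.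
    by rewrite -powR_mulrn ?(ltW x0)// -[in RHS](prednK m0) -natr1 addrK.
  rewrite (_ : s `^ c = s `^ (c - 1) * s); last first.
    by rewrite -{3}(powRr1 (ltW s0)) -powRD ?subrK// (lt0r_neq0 s0) implybT.
  rewrite (_ : m%:R * c - 1 = m%:R * (c - 1) + (m%:R - 1)); last by ring.
  by rewrite (@powRD _ x (m%:R * (c - 1)) (m%:R - 1)) ?(lt0r_neq0 x0) ?implybT//; ring.
rewrite ge0_integralZl//; last 3 first.
- apply/measurable_EFinP/measurable_funTS; apply: measurable_funM; first exact: measurable_powR.
  apply: (measurableT_comp (@measurable_expR R)); apply: measurable_funN.
  by apply: measurable_funM => //; exact: measurable_funX.
- by move=> x _; rewrite lee_fin mulr_ge0 ?powR_ge0 ?expR_ge0.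
- by rewrite lee_fin mulr_ge0 ?powR_ge0.
move=> h; rewrite (_ : _ / _ = (s `^ c * m%:R)^-1 * Gamma c); last first.
  by rewrite powRN invfM; ring.
rewrite EFinM h muleA -EFinM mulVf ?mul1e// mulf_neq0 ?lt0r_neq0// powR_gt0//.
Qed.

Lemma kummerU_integralE a b x : kummerU_integral a b x = Kappa (a - 1) (b - a - 1) x / Gamma a.
Proof. by rewrite /kummerU_integral mulrC. Qed.

Lemma Kappa_split p q x : -1 < p -> 0 < x ->
  Kappa p (q + 1) x = Kappa (p + 1) q x + Kappa p q x.
Proof.
move=> p1 x0; rewrite /Kappa -RintegralD; last 3 first.
- exact: measurable_half_line.
- by apply: kappa_integrable => //; lra.
- exact: kappa_integrable.
by apply: eq_Rintegral => t; rewrite inE half_lineE => t0; exact: kappa_split.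
Qed.

(** Integration by parts combined with two splittings of a factor [t + 1]. The coefficients keep the
    shape [u * a + v] so that [analytic_at_affine] matches them. *)
Lemma kummerU_integral_rec b x a : 0 < x -> 0 < a ->
  kummerU_integral a b x = (2 * a + (x + 2 - b)) * kummerU_integral (a + 1) b x
    + (1 * a + 1) * ((- 1) * a + (b - 2)) * kummerU_integral (a + 2) b x.
Proof.
move=> x0 a0; rewrite !kummerU_integralE.
rewrite (_ : a + 2 = a + 1 + 1); last by ring.
rewrite !Gamma_rec ?addr_gt0//.
have := Kappa_rec (b - a - 2) a0 x0.
have := @Kappa_split (a - 1) (b - a - 2) x; rewrite subrK.
have := @Kappa_split a (b - a - 2 - 1) x; rewrite subrK.
rewrite (_ : b - a - 1 = b - a - 2 + 1); last by ring.
rewrite (_ : b - (a + 1) - 1 = b - a - 2); last by ring.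
rewrite (_ : b - (a + 1 + 1) - 1 = b - a - 2 - 1); last by ring.
rewrite !addrK; set K0 := Kappa (a - 1) (b - a - 2 + 1) x; set K1 := Kappa a _ x; set K2 := Kappa (a + 1) _ x.
set L1 := Kappa (a - 1) _ x; set L2 := Kappa a _ x.
have Ga := lt0r_neq0 (Gamma_gt0 a0).
have a1 : a + 1 != 0 by rewrite lt0r_neq0// addr_gt0.
move=> h1 h2 h3.
have {}h1 : K1 = K2 + L2 by apply: h1 => //; lra.
have {}h2 : K0 = K1 + L1 by apply: h2 => //; lra.
(* Eliminating the auxiliary integrals [L1] and [L2] leaves the contiguity relation, still without
   the [Gamma] normalisation. *)
have e : a * K0 = (2 * a + (x + 2 - b)) * K1 + ((- 1) * a + (b - 2)) * K2.
  rewrite h2 (_ : K2 = K1 - L2); last by rewrite h1 addrK.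
  have -> : x + 2 - b = 2 - b + x by ring.
  rewrite mulrDr; have -> : a * L1 = x * K1 - (b - a - 2) * L2 by rewrite -h3 addrK.
  by ring.
apply: (mulfI (lt0r_neq0 a0)); rewrite [LHS]mulrA e.
by field; rewrite Ga a1 lt0r_neq0.
Qed.

End gamma.

(** * Analytic dependence of an integral on an exponent *)

Section parametric.
Variable R : realType.
Implicit Types (p q x t a b c : R).

Local Notation nu := (@lebesgue_measure R).
Local Notation D := (`]0, +oo[%classic : set R).

Lemma exp_series_le (x : R) n : 0 <= x -> \sum_(0 <= i < n) x ^+ i / i`!%:R <= expR x.
Proof.
move=> x0; have := @nondecreasing_cvgn_le R (series (exp_coeff x)).
move=> /(_ _ (is_cvg_series_exp_coeff x) n); apply.
by apply: nondecreasing_series => i _ _; rewrite exp_coeff_ge0.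
Qed.

Lemma half_line_RintegralZl (f : R -> R) a : nu.-integrable D (EFin \o f) ->
  \int[nu]_(t in D) (a * f t) = a * \int[nu]_(t in D) f t.
Proof. by move=> fi; rewrite RintegralZl. Qed.

Lemma half_line_RintegralD (f g : R -> R) :
  nu.-integrable D (EFin \o f) -> nu.-integrable D (EFin \o g) ->
  \int[nu]_(t in D) (f t + g t) = \int[nu]_(t in D) f t + \int[nu]_(t in D) g t.
Proof. by move=> fi gi; rewrite RintegralD. Qed.

Lemma Rintegral_sum (g : nat -> R -> R) n : (forall i, nu.-integrable D (EFin \o g i)) ->
  nu.-integrable D (EFin \o (fun t => \sum_(0 <= i < n) g i t)) /\
  \int[nu]_(t in D) (\sum_(0 <= i < n) g i t) = \sum_(0 <= i < n) \int[nu]_(t in D) g i t.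
Proof.
move=> gi; elim: n => [|n [IH1 IH2]].
  rewrite (_ : (fun t => _) = cst 0); last by apply/funext => t; rewrite big_nil.
  by split; [exact: integrable0|rewrite big_nil /Rintegral integral0].
rewrite (_ : (fun t => _) = (fun t => \sum_(0 <= i < n) g i t + g n t)); last first.
  by apply/funext => t; rewrite big_nat_recr.
split; first exact: integrable_add.
by rewrite RintegralD// IH2 big_nat_recr.
Qed.

Variables l k : R -> R.
Hypotheses (ml : measurable_fun setT l) (mk : measurable_fun setT k).
Hypothesis k0 : forall t, 0 <= k t.
Hypothesis lk : forall a : R, 0 < a -> nu.-integrable D (EFin \o (fun t => expR (a * l t) * k t)).

(** Comes from [exp (|h| |l|) <= exp (|h| l) + exp (- |h| l)], which covers both signs of [l t]; it
    is integrable as long as [h < a]. *)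
Let majorant (h a : R) t := expR ((a + h) * l t) * k t + expR ((a - h) * l t) * k t.

Let majorant_integrable h a : 0 <= h -> h < a -> nu.-integrable D (EFin \o majorant h a).
Proof. by move=> h0 ha; apply: integrable_add => //; apply: lk; lra. Qed.

Let majorant_ge0 h a t : 0 <= majorant h a t.
Proof. by rewrite addr_ge0// mulr_ge0 ?expR_ge0. Qed.

Let term (a : R) n t := l t ^+ n / n`!%:R * (expR (a * l t) * k t).

Let term_sum h a n t :
  \sum_(0 <= i < n) `|h ^+ i * term a i t| <= majorant `|h| a t.
Proof.
have E : 0 <= expR (a * l t) * k t by rewrite mulr_ge0 ?expR_ge0.
apply: (@le_trans _ _ (expR (`|h| * `|l t|) * (expR (a * l t) * k t))).
  apply: le_trans (ler_wpM2r E (exp_series_le n (mulr_ge0 (normr_ge0 h) (normr_ge0 (l t))))).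
  rewrite mulr_suml; apply: ler_sum => i _.
  rewrite /term mulrA normrM (ger0_norm E); apply: ler_wpM2r => //.
  by rewrite mulrA !normrM !normrX normfV normr_nat exprMn.
have -> : majorant `|h| a t =
    (expR (`|h| * l t) + expR (- `|h| * l t)) * (expR (a * l t) * k t).
  by rewrite /majorant ![(_ + _) * l t]mulrDl !expRD; ring.
apply: ler_wpM2r => //.
have [l0|l0] := leP 0 (l t).
  by rewrite (ger0_norm l0) lerDl expR_ge0.
by rewrite (ltr0_norm l0) mulrN -mulNr lerDr expR_ge0.
Qed.

Let mterm a n : measurable_fun D (term a n).
Proof.
apply: measurable_funTS; apply: measurable_funM.
  by apply: measurable_funM => //; exact: measurable_funX.
apply: measurable_funM => //; apply: (measurableT_comp (@measurable_expR R)).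
exact: measurable_funM.
Qed.

(** One term of [term_sum], taken at [h = a / 2] and divided by [h ^+ n]. *)
Let term_integrable a n : 0 < a -> nu.-integrable D (EFin \o term a n).
Proof.
move=> a0; pose d := a / 2; have d0 : 0 < d by rewrite divr_gt0.
have da : d < a by rewrite /d; lra.
have dn : 0 < d ^+ n by rewrite exprn_gt0.
apply: (@le_integrable _ _ _ nu D _ _ (EFin \o (fun t => d ^- n * majorant d a t))) => //.
- by apply/measurable_EFinP; exact: mterm.
- move=> t _ /=; rewrite lee_fin [leRHS]ger0_norm ?mulr_ge0 ?invr_ge0 ?(ltW dn) ?majorant_ge0//.
  have h : `|d ^+ n * term a n t| <= majorant `|d| a t.
    by apply: le_trans (term_sum d a n.+1 t); rewrite big_nat_recr// ler_wpDl// sumr_ge0.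
  by rewrite normrM (gtr0_norm dn) (gtr0_norm d0) in h; rewrite ler_pdivlMl.
- by apply: integrable_scale => //; apply: majorant_integrable => //; exact: ltW.
Qed.

(** Expand [exp (h l t)] in powers of [h = a - a0]. The partial sums are dominated by [majorant], so
    integration commutes with the expansion, and the radius is the full distance [a0] to the
    origin. *)
Lemma parametric_analytic a0 : 0 < a0 ->
  analytic_at (fun a => \int[nu]_(t in D) (expR (a * l t) * k t)) a0.
Proof.
move=> a00; exists a0 => //.
exists (fun n => \int[nu]_(t in D) term a0 n t) => a.
set h := a - a0 => ha.
have hi i : nu.-integrable D (EFin \o (fun t => h ^+ i * term a0 i t)).
  by apply: integrable_scale => //; exact: term_integrable.
rewrite (_ : series _ = fun n => \int[nu]_(t in D) (\sum_(0 <= i < n) h ^+ i * term a0 i t)); last first.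
  apply/funext => n; rewrite (Rintegral_sum n hi).2 seriesEnat/=.
  apply: eq_bigr => i _; rewrite mulrC.
  by apply/esym/half_line_RintegralZl; exact: term_integrable.
have a0' : 0 < a by move: ha; rewrite /h ltr_norml; lra.
have [] := @dominated_convergence _ _ R nu D (@measurable_half_line R)
  (fun n t => (\sum_(0 <= i < n) h ^+ i * term a0 i t)%:E)
  (fun t => (expR (a * l t) * k t)%:E) (fun t => (majorant `|h| a0 t)%:E).
- by move=> n; exact: (measurable_int _ (Rintegral_sum n hi).1).
- exact: (measurable_int _ (lk a0')).
- apply: aeW => t _; apply: cvg_EFin; first exact: nearW.
  have -> : expR (a * l t) * k t = expR (h * l t) * (expR (a0 * l t) * k t).
    by rewrite mulrA -expRD /h; congr (expR _ * _); ring.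
  have cv : series (exp_coeff (h * l t)) @ \oo --> expR (h * l t).
    exact: is_cvg_series_exp_coeff.
  rewrite [X in X @ _ --> _](_ : _ = fun n =>
    series (exp_coeff (h * l t)) n * (expR (a0 * l t) * k t)).
    by apply: cvgM => //; exact: cvg_cst.
  apply/funext => n /=; rewrite seriesEnat/= mulr_suml; apply: eq_bigr => i _.
  by rewrite /term /exp_coeff/= exprMn; ring.
- exact: (majorant_integrable (normr_ge0 h) ha).
- apply: aeW => t n _; rewrite abse_EFin lee_fin.
  by apply: (le_trans (ler_norm_sum _ _ _)); exact: term_sum.
move=> fi _ H; rewrite /Rintegral; apply: fine_cvg.
by rewrite fineK//; exact: integrable_fin_num.
Qed.

End parametric.

(** * Continuation of the Kummer function, and the Beta-type double integrals *)

Section kummer.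
Variable R : realType.
Implicit Types (p q x t a b c d : R).

Local Notation nu := (@lebesgue_measure R).
Local Notation D := (`]0, +oo[%classic : set R).

Lemma powR_exp t p : 0 < t -> t `^ p = expR (p * ln t).
Proof. by move=> t0; rewrite /powR gt_eqF. Qed.

Lemma Kappa_analytic b x a0 : 0 < x -> 0 < a0 ->
  analytic_at (fun a => Kappa (a - 1) (b - a - 1) x) a0.
Proof.
(* With this [l] the dependence on [a] becomes [exp (a l t)]. The remaining kernel, with exponent -1
   at the origin, is not integrable alone but becomes so for every [a > 0]. *)
move=> x0 a00; pose l t : R := ln t - ln (t + 1).
have E a t : D t -> kappa (a - 1) (b - a - 1) x t = expR (a * l t) * kappa (- 1) (b - 1) x t.
  rewrite half_lineE => t0; have t1 : 0 < t + 1 by rewrite addr_gt0.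
  have e1 : t `^ (a - 1) = t `^ a * t `^ (- 1).
    by rewrite (@powRD _ t a (- 1)) ?(lt0r_neq0 t0) ?implybT.
  have e2 : (t + 1) `^ (b - a - 1) = (t + 1) `^ (- a) * (t + 1) `^ (b - 1).
    rewrite (_ : b - a - 1 = - a + (b - 1)); last by ring.
    by rewrite (@powRD _ (t + 1) (- a)) ?(lt0r_neq0 t1) ?implybT.
  have e3 : expR (a * l t) = t `^ a * (t + 1) `^ (- a).
    by rewrite (powR_exp a t0) (powR_exp (- a) t1) -expRD mulNr -mulrBr.
  by rewrite /kappa e1 e2 e3; ring.
have H := @parametric_analytic R l (kappa (- 1) (b - 1) x) _ _ (fun t => kappa_ge0 _ _ _ t) _ a0 a00.
apply: (@analytic_at_congr _ _ _ _ 1 ltr01 _ (H _ _ _)).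
- move=> a _; apply/esym/eq_Rintegral => t; rewrite inE; exact: E.
- apply: measurable_funB; first exact: measurable_ln.
  by apply: (measurableT_comp (@measurable_ln R)); exact: measurable_funD.
- exact: measurable_kappa.
- move=> a a1; apply: eq_integrable (kappa_integrable (b - a - 1) (_ : -1 < a - 1) x0) => //.
    by move=> t; rewrite inE /= => Dt; rewrite E.
  by lra.
Qed.

Lemma Gamma_analytic a0 : 0 < a0 -> analytic_at (@Gamma R) a0.
Proof.
move=> a00.
have E a t : D t -> kappa (a - 1) 0 1 t = expR (a * ln t) * kappa (- 1) 0 1 t.
  rewrite half_lineE => t0.
  have e1 : t `^ (a - 1) = t `^ a * t `^ (- 1).
    by rewrite (@powRD _ t a (- 1)) ?(lt0r_neq0 t0) ?implybT.
  by rewrite /kappa e1 (powR_exp a t0); ring.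
have H := @parametric_analytic R (@ln R) (kappa (- 1) 0 1) _ _ (fun t => kappa_ge0 _ _ _ t) _ a0 a00.
apply: (@analytic_at_congr _ _ _ _ 1 ltr01 _ (H _ _ _)).
- move=> a _; rewrite GammaE; apply/esym/eq_Rintegral => t; rewrite inE; exact: E.
- exact: measurable_ln.
- exact: measurable_kappa.
- move=> a a1; apply: eq_integrable (kappa_integrable 0 (_ : -1 < a - 1) (ltr01 : (0 : R) < 1)) => //.
    by move=> t; rewrite inE /= => Dt; rewrite E.
  by lra.
Qed.

Lemma kummerU_integral_analytic b x a0 : 0 < x -> 0 < a0 ->
  analytic_at (fun a => kummerU_integral a b x) a0.
Proof.
move=> x0 a00; apply: (@analytic_at_congr _ (fun a => Kappa (a - 1) (b - a - 1) x * (Gamma a)^-1) _ _ 1) => //.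
  by move=> a _; rewrite kummerU_integralE.
apply: analytic_atM; first exact: Kappa_analytic.
apply: analytic_atV; first exact: Gamma_analytic.
exact: lt0r_neq0 (Gamma_gt0 a00).
Qed.

(* Both integrals on the right-hand side converge as soon as -1 < a. *)
Lemma kummerU_contiguous a b x : 0 < x -> -1 < a ->
  kummerU a b x = (2 * a + (x + 2 - b)) * kummerU_integral (a + 1) b x
    + (1 * a + 1) * ((- 1) * a + (b - 2)) * kummerU_integral (a + 2) b x.
Proof.
move=> x0 a1.
pose u (s : R) := kummerU_integral s b x.
pose p (s : R) : R := 2 * s + (x + 2 - b).
pose q (s : R) : R := (1 * s + 1) * ((- 1) * s + (b - 2)).
have uan (s : R) : 0 < s -> analytic_at u s by exact: kummerU_integral_analytic.
have pan (s : R) : analytic_at p s by exact: analytic_at_affine.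
have qan (s : R) : analytic_at q s by apply: analytic_atM; exact: analytic_at_affine.
have urec (s : R) : 0 < s -> u s = p s * u (s + 1) + q s * u (s + 2).
  by move=> s0; rewrite /u kummerU_integral_rec.
rewrite (@kummerUE _ _ _ (analytic_extension u p q)).
  by rewrite (@analytic_extensionE _ u p q urec 1).
split; first exact: analytic_extension_analytic.
by move=> t t0; rewrite (@analytic_extensionE _ u p q urec 0) ?oppr0.
Qed.

(** The integrand is extended by zero outside the quadrant. Measurability of the inner integral is
    recorded because the weights obtain theirs from it. *)
Lemma tonelli_half_line (f : R -> R -> R) :
  measurable_fun setT (fun z : R * R => f z.1 z.2) -> (forall x y : R, 0 <= f x y) ->
  (\int[nu]_(x in D) \int[nu]_(y in D) (f x y)%:E =
   \int[nu]_(y in D) \int[nu]_(x in D) (f x y)%:E)%E /\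
  measurable_fun D (fun x => (\int[nu]_(y in D) (f x y)%:E)%E).
Proof.
move=> mf f0; have mD := @measurable_half_line R.
pose g : R * R -> \bar R := (EFin \o (fun z => f z.1 z.2)) \_ (D `*` D).
have mg : measurable_fun setT g.
  have mDD : measurable (D `*` D : set (R * R)) by exact: measurableX.
  apply: (measurable_restrictT _ mDD).1.
  by apply: measurable_funTS; exact/measurable_EFinP.
have g0 z : (0 <= g z)%E by rewrite /g patchE; case: ifPn => // _; rewrite lee_fin.
have g1 x : (\int[nu]_y g (x, y) = ((fun x => \int[nu]_(y in D) (f x y)%:E) \_ D) x)%E.
  rewrite patchE; case: ifPn => xD.
    rewrite [RHS]integral_mkcond; apply: eq_integral => y _.
    by rewrite /g !patchE in_setX xD.
  by apply: integral0_eq => y _; rewrite /g patchE in_setX (negbTE xD).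
have g2 y : (\int[nu]_x g (x, y) = ((fun y => \int[nu]_(x in D) (f x y)%:E) \_ D) y)%E.
  rewrite patchE; case: ifPn => yD.
    rewrite [RHS]integral_mkcond; apply: eq_integral => x _.
    by rewrite /g !patchE in_setX yD andbT.
  by apply: integral0_eq => x _; rewrite /g patchE in_setX (negbTE yD) andbF.
split.
  rewrite integral_mkcond [RHS]integral_mkcond.
  under eq_integral do rewrite -g1.
  under [RHS]eq_integral do rewrite -g2.
  exact: (@fubini_tonelli _ _ _ _ _ nu nu g mg g0).
apply: (measurable_restrictT _ mD).2.
have := @measurable_fun_fubini_tonelli_F _ _ _ _ _ nu g mg g0.
rewrite /fubini_F.
suff -> : (fun x => \int[nu]_y g (x, y))%E = (fun x => \int[nu]_(y in D) (f x y)%:E)%E \_ D by [].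
by apply/funext => x; exact: g1.
Qed.

Lemma half_line_integralZl (k : R) (f : R -> R) : 0 <= k ->
  measurable_fun setT f -> (forall t, 0 <= f t) ->
  (\int[nu]_(t in D) (k * f t)%:E = k%:E * \int[nu]_(t in D) (f t)%:E)%E.
Proof.
move=> k0 mf f0; under eq_integral do rewrite EFinM.
rewrite ge0_integralZl//; first exact/measurable_EFinP/measurable_funTS.
by move=> t _; rewrite lee_fin.
Qed.

Lemma measurable_powR_expR (p s : R) n :
  measurable_fun setT (fun x : R => x `^ p * expR (- (s * x ^+ n))).
Proof.
apply: measurable_funM; first exact: measurable_powR.
apply: (measurableT_comp (@measurable_expR R)); apply: measurable_funN.
by apply: measurable_funM => //; exact: measurable_funX.
Qed.

Lemma Gamma_exp_integral (s c : R) : 0 < s -> 0 < c ->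
  (\int[nu]_(t in D) (t `^ (c - 1) * expR (- (s * t ^+ 1)))%:E = (s `^ (- c) * Gamma c)%:E)%E.
Proof.
move=> s0 c0; have := @Gamma_power_integral R 1 s c isT s0 c0.
by rewrite divr1 (mul1r c).
Qed.

(** Integrate [t ^ (a - 1) s ^ (a + d - 1) exp (- (t + 1) s)] in both orders: [s] first gives the
    Beta kernel times [Gamma (a + d)], [t] first gives [Gamma a * Gamma d]. *)
Lemma beta_integral a d : 0 < a -> 0 < d ->
  (\int[nu]_(t in D) (kappa (a - 1) (- a - d) 0 t)%:E =
   (Gamma a * Gamma d / Gamma (a + d))%:E)%E.
Proof.
move=> a0 d0; have ad : 0 < a + d by rewrite addr_gt0.
have Gad := Gamma_gt0 ad.
pose f (t s : R) := t `^ (a - 1) * (s `^ (a + d - 1) * expR (- ((t + 1) * s ^+ 1))).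
have mf : measurable_fun setT (fun z : R * R => f z.1 z.2).
  apply: measurable_funM; first exact: (measurableT_comp (measurable_powR _)).
  apply: measurable_funM; first exact: (measurableT_comp (measurable_powR _)).
  apply: (measurableT_comp (@measurable_expR R)); apply: measurable_funN.
  by apply: measurable_funM; [exact: (@measurable_funD _ _ R setT fst (cst 1))|exact: (@measurable_funX _ _ R setT snd 1)].
have pe0 (p x u : R) : 0 <= x `^ p * expR u by rewrite mulr_ge0 ?powR_ge0 ?expR_ge0.
have f0 (t s : R) : 0 <= f t s by rewrite mulr_ge0 ?powR_ge0.
have [H _] := tonelli_half_line mf f0.
have E1 : (\int[nu]_(t in D) \int[nu]_(s in D) (f t s)%:E =
    (Gamma (a + d))%:E * \int[nu]_(t in D) (kappa (a - 1) (- a - d) 0 t)%:E)%E.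
  rewrite -(half_line_integralZl (ltW Gad) (measurable_kappa _ _ _) (kappa_ge0 _ _ _)).
  apply: eq_integral => t; rewrite inE half_lineE => t0.
  have t1 : 0 < t + 1 by rewrite addr_gt0.
  have := half_line_integralZl (powR_ge0 t (a - 1))
    (measurable_powR_expR (a + d - 1) (t + 1) 1) (fun s => pe0 _ _ _).
  rewrite /f => ->.
  rewrite (Gamma_exp_integral t1 ad) -EFinM; congr (_%:E).
  by rewrite /kappa mulr0 oppr0 expR0 opprD; ring.
have E2 : (\int[nu]_(s in D) \int[nu]_(t in D) (f t s)%:E = (Gamma a * Gamma d)%:E)%E.
  (* The factor 1 is read as 1 to the power [- d], which turns [Gamma d] into the exponential
     integral with [s = 1]. *)
  rewrite EFinM -(mul1r (Gamma d)) -(congr1 (fun f => f (- d)) (powR1 R)).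
  rewrite -(Gamma_exp_integral ltr01 d0).
  rewrite -(half_line_integralZl (ltW (Gamma_gt0 a0))
    (measurable_powR_expR (d - 1) 1 1) (fun s => pe0 _ _ _)).
  apply: eq_integral => s; rewrite inE half_lineE => s0.
  transitivity ((s `^ (a + d - 1) * expR (- s))%:E *
     \int[nu]_(x in D) (x `^ (a - 1) * expR (- (s * x ^+ 1)))%:E)%E.
    rewrite -(half_line_integralZl (pe0 _ _ _)
      (measurable_powR_expR (a - 1) s 1) (fun t => pe0 _ _ _)).
    apply: eq_integral => t _; congr (_%:E).
    by rewrite /f !expr1 mulrDl mul1r opprD expRD (mulrC s); ring.
  rewrite (Gamma_exp_integral s0 a0) -EFinM; congr (_%:E).
  rewrite (_ : a + d - 1 = (d - 1) + a); last by ring.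
  have e : s `^ (d - 1 + a) = s `^ (d - 1) * s `^ a.
    by rewrite (@powRD _ s (d - 1) a) ?(lt0r_neq0 s0) ?implybT.
  have sa : s `^ a != 0 by apply: lt0r_neq0; exact: powR_gt0.
  by rewrite e powRN expr1 (mul1r s); field.
have -> : Gamma a * Gamma d / Gamma (a + d) = (Gamma (a + d))^-1 * (Gamma a * Gamma d).
  by rewrite mulrC.
rewrite EFinM -E2 -H E1 muleA -EFinM (mulVf (lt0r_neq0 Gad)).
by rewrite mul1e.
Qed.

(** Integrating over [x] first yields [(t + 1) ^ (- c) Gamma c / 3]; the exponent [c - d - a], which
    is [b - a - 1] for [b = c + 1 - d], then drops to [- a - d] and a Beta integral remains. *)
Lemma kummer_tonelli a c d : 0 < a -> 0 < c -> 0 < d ->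
  let W (x : R) := x `^ (3 * c - 1) * expR (- x ^+ 3) * Kappa (a - 1) (c - d - a) (x ^+ 3) in
  nu.-integrable D (EFin \o W) /\
  \int[nu]_(x in D) W x = Gamma a * (Gamma c * Gamma d / (3 * Gamma (a + d))).
Proof.
move=> a0 c0 d0 W.
pose f (x t : R) := x `^ (3 * c - 1) * expR (- x ^+ 3) * kappa (a - 1) (c - d - a) (x ^+ 3) t.
have mf : measurable_fun setT (fun z : R * R => f z.1 z.2).
  apply: measurable_funM; first apply: measurable_funM.
  - exact: (measurableT_comp (measurable_powR _)).
  - apply: (measurableT_comp (@measurable_expR R)); apply: measurable_funN.
    exact: measurable_funX.
  - apply: measurable_funM; first apply: measurable_funM.
    + exact: (measurableT_comp (measurable_powR _)).
    + by apply: (measurableT_comp (measurable_powR _)); exact: (@measurable_funD _ _ R setT snd (cst 1)).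
    + apply: (measurableT_comp (@measurable_expR R)); apply: measurable_funN.
      by apply: measurable_funM => //; exact: measurable_funX.
have pe0 (p x u : R) : 0 <= x `^ p * expR u by rewrite mulr_ge0 ?powR_ge0 ?expR_ge0.
have f0 (x t : R) : 0 <= f x t by rewrite mulr_ge0// kappa_ge0.
have [H mH] := tonelli_half_line mf f0.
have WE (x : R) : 0 < x -> (\int[nu]_(t in D) (f x t)%:E = (W x)%:E)%E.
  move=> x0.
  have := half_line_integralZl (pe0 (3 * c - 1) x (- x ^+ 3))
    (measurable_kappa (a - 1) (c - d - a) (x ^+ 3)) (kappa_ge0 _ _ _).
  rewrite /f => ->.
  have a1 : -1 < a - 1 by lra.
  by rewrite (KappaE (c - d - a) a1 (exprn_gt0 3 x0)) -EFinM.
have W0 (x : R) : 0 <= W x by apply: mulr_ge0; [exact: pe0|exact: Kappa_ge0].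
have IW : (\int[nu]_(x in D) (W x)%:E =
    (Gamma a * (Gamma c * Gamma d / (3 * Gamma (a + d))))%:E)%E.
  transitivity (\int[nu]_(x in D) \int[nu]_(t in D) (f x t)%:E)%E.
    by apply: eq_integral => x; rewrite inE half_lineE => x0; rewrite WE.
  rewrite H.
  transitivity ((Gamma c / 3)%:E * \int[nu]_(t in D) (kappa (a - 1) (- a - d) 0 t)%:E)%E.
    have Gc3 : 0 <= Gamma c / 3 by apply: divr_ge0; [exact: ltW (Gamma_gt0 c0)|exact: ler0n].
    rewrite -(half_line_integralZl Gc3 (measurable_kappa _ _ _) (kappa_ge0 _ _ _)).
    apply: eq_integral => t; rewrite inE half_lineE => t0.
    have t1 : 0 < t + 1 by rewrite addr_gt0.
    transitivity ((t `^ (a - 1) * (t + 1) `^ (c - d - a))%:E *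
       \int[nu]_(x in D) (x `^ (3 * c - 1) * expR (- ((t + 1) * x ^+ 3)))%:E)%E.
      rewrite -(half_line_integralZl (mulr_ge0 (powR_ge0 _ _) (powR_ge0 _ _))
        (measurable_powR_expR (3 * c - 1) (t + 1) 3) (fun x => pe0 _ _ _)).
      apply: eq_integral => x _; congr (_%:E).
      have -> : - ((t + 1) * x ^+ 3) = - (t * x ^+ 3) - x ^+ 3 by ring.
      by rewrite /f /kappa expRD; ring.
    rewrite (@Gamma_power_integral R 3 (t + 1) c isT t1 c0) -EFinM; congr (_%:E).
    rewrite /kappa mulr0 oppr0 expR0 mulr1.
    rewrite (_ : - a - d = (c - d - a) - c); last by ring.
    have e : (t + 1) `^ (c - d - a - c) = (t + 1) `^ (c - d - a) * (t + 1) `^ (- c).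
      by rewrite (@powRD _ (t + 1) (c - d - a) (- c)) ?(lt0r_neq0 t1) ?implybT.
    by rewrite e; ring.
  rewrite (beta_integral a0 d0) -EFinM; congr (_%:E).
  by move: (Gamma a) (Gamma c) (Gamma d) (Gamma (a + d)) => *; rewrite invfM; ring.
split; last by rewrite /Rintegral IW.
apply/integrableP; split.
  apply: eq_measurable_fun mH => x; rewrite inE half_lineE => x0.
  by rewrite WE.
rewrite (_ : (\int[nu]_(x in D) _ = \int[nu]_(x in D) (W x)%:E)%E); last first.
  by apply: eq_integral => x _; rewrite gee0_abs ?lee_fin.
by rewrite IW ltry.
Qed.

End kummer.

(** * Moments *)

Section moments.
Variable R : realType.
Implicit Types (p q x t a b c d : R).

Local Notation nu := (@lebesgue_measure R).
Local Notation D := (`]0, +oo[%classic : set R).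

Local Opaque Gamma Kappa kummerU.

(** By contiguity the weight is a combination of three weights with positive first parameter. The
    summand [x] in the contiguity coefficient, here [x ^+ 3], raises [c] by one; raising [d] as well
    keeps [b] fixed, which explains the parameters of [i1]. *)
Lemma kummerU_moment a b c d : -1 < a -> 0 < c -> 0 < d -> 0 < a + d -> b = c + 1 - d ->
  let W (x : R) := x `^ (3 * c - 1) * expR (- x ^+ 3) * kummerU a b (x ^+ 3) in
  nu.-integrable D (EFin \o W) /\
  \int[nu]_(x in D) W x = Gamma c * Gamma d / (3 * Gamma (a + d)).
Proof.
move=> a1 c0 d0 ad0 bE W.
have a10 : 0 < a + 1 by lra.
have a20 : 0 < a + 2 by lra.
have c10 : 0 < c + 1 by lra.
have d10 : 0 < d + 1 by lra.
have [i1 e1] := kummer_tonelli a10 c10 d10.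
have [i2 e2] := kummer_tonelli a10 c0 d0.
have [i3 e3] := kummer_tonelli a20 c0 d0.
set W1 := (fun x : R => _) in i1 e1.
set W2 := (fun x : R => _) in i2 e2.
set W3 := (fun x : R => _) in i3 e3.
have WE x : D x -> W x = (Gamma (a + 1))^-1 * W1 x
    + (2 * a + 2 - b) / Gamma (a + 1) * W2 x
    + (a + 1) * (b - 2 - a) / Gamma (a + 2) * W3 x.
  rewrite half_lineE => x0; rewrite /W kummerU_contiguous ?exprn_gt0//.
  rewrite !kummerU_integralE /W1 /W2 /W3.
  rewrite (_ : c + 1 - (d + 1) - (a + 1) = c - d - (a + 1)); last by ring.
  rewrite (_ : b - (a + 1) - 1 = c - d - (a + 1)); last by rewrite bE; ring.
  rewrite (_ : b - (a + 2) - 1 = c - d - (a + 2)); last by rewrite bE; ring.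
  have -> : x `^ (3 * (c + 1) - 1) = x `^ (3 * c - 1) * x ^+ 3.
    rewrite (_ : 3 * (c + 1) - 1 = (3 * c - 1) + 3); last by ring.
    rewrite (@powRD _ x (3 * c - 1) 3) ?(lt0r_neq0 x0) ?implybT//.
    by rewrite (@powR_mulrn _ x 3 (ltW x0)).
  move: (x `^ _) (expR _) (Kappa (a + 1 - 1) _ _) (Kappa (a + 2 - 1) _ _).
  move: (Gamma (a + 1)) (Gamma (a + 2)) => G1 G2 X1 X2 X3 X4.
  by ring.
clearbody W W1 W2 W3.
have j1 := integrable_scale (Gamma (a + 1))^-1 (@measurable_half_line R) i1.
have j2 := integrable_scale ((2 * a + 2 - b) / Gamma (a + 1)) (@measurable_half_line R) i2.
have j3 := integrable_scale ((a + 1) * (b - 2 - a) / Gamma (a + 2)) (@measurable_half_line R) i3.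
have j12 := integrable_add (@measurable_half_line R) j1 j2.
have j123 := integrable_add (@measurable_half_line R) j12 j3.
split.
  apply: eq_integrable j123 => //.
  by move=> x; rewrite inE /= => Dx; rewrite WE.
transitivity (\int[nu]_(x in D) ((Gamma (a + 1))^-1 * W1 x
    + (2 * a + 2 - b) / Gamma (a + 1) * W2 x
    + (a + 1) * (b - 2 - a) / Gamma (a + 2) * W3 x)).
  by apply: eq_Rintegral => x; rewrite inE; exact: WE.
rewrite (half_line_RintegralD j12 j3) (half_line_RintegralD j1 j2).
rewrite (half_line_RintegralZl _ i1) (half_line_RintegralZl _ i2) (half_line_RintegralZl _ i3).
rewrite e1 e2 e3.
rewrite (_ : a + 1 + (d + 1) = a + d + 1 + 1); last by ring.
rewrite (_ : a + 2 + d = a + d + 1 + 1); last by ring.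
rewrite (_ : a + 1 + d = a + d + 1); last by ring.
have ad1 : 0 < a + d + 1 by rewrite addr_gt0.
rewrite (@Gamma_rec _ (a + d + 1))// (@Gamma_rec _ (a + d))// (@Gamma_rec _ c)// (@Gamma_rec _ d)//.
have := Gamma_gt0 a10; have := Gamma_gt0 a20; have := Gamma_gt0 ad0.
move=> /lt0r_neq0 + /lt0r_neq0 + /lt0r_neq0.
move: (Gamma (a + d)) (Gamma (a + 1)) (Gamma (a + 2)) (Gamma c) (Gamma d).
move=> G1 G2 G3 G4 G5 g1 g2 g3; have := lt0r_neq0 ad0; have := lt0r_neq0 ad1.
by move=> h1 h2; rewrite bE; field; rewrite g1 g2 g3 h1 h2.
Qed.

Lemma Gamma_rising c n : 0 < c -> Gamma (c + n%:R) = rising c n * Gamma c.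
Proof.
move=> c0; elim: n => [|n IH]; first by rewrite addr0 rising0 mul1r.
by rewrite -natr1 addrA Gamma_rec ?IH ?risingSr 1?mulrCA ?mulrA// ltr_wpDr.
Qed.

(** The factors of [(3m)!] are grouped by residue modulo 3: the multiples of 3 give [3 ^ m m!], the
    two other classes [3 ^ m] times a rising factorial each. *)
Lemma fact3_rising m :
  (3 * m)`!%:R = 27 ^+ m * m`!%:R * (rising (1 / 3) m * rising (2 / 3) m) :> R.
Proof.
elim: m => [|m IH]; first by rewrite muln0 fact0 !rising0 expr0 !mulr1.
rewrite mulnS add3n !factS !natrM IH !risingSr exprS -!natr1 natrM.
by field.
Qed.

Lemma fact31_rising m :
  (3 * m + 1)`!%:R = 27 ^+ m * m`!%:R * (rising (4 / 3) m * rising (2 / 3) m) :> R.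
Proof.
elim: m => [|m IH]; first by rewrite muln0 fact0 !rising0 expr0 !mulr1.
rewrite mulnS add3n !addSn !factS !natrM IH !risingSr exprS -!natr1 natrD natrM.
by field.
Qed.

Variable mu : R.
Hypothesis hmu : -1 < mu.

(** [kummerU_moment] with [a = mu/3], [c = (i+1)/3], [d = (i+2)/3], for which [3c - 1 = i] and
    [c + 1 - d = 2/3]. *)
Lemma calU0_moment i :
  nu.-integrable D (EFin \o (fun t => t ^+ i * calU0 mu t)) /\
  \int[nu]_(t in D) (t ^+ i * calU0 mu t) =
    3 * Gamma ((mu + 2) / 3) / (Gamma (1 / 3) * Gamma (2 / 3)) *
    (Gamma ((i%:R + 1) / 3) * Gamma ((i%:R + 2) / 3) / (3 * Gamma ((mu + 2 + i%:R) / 3))).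
Proof.
have a1 : -1 < mu / 3 by move: hmu; lra.
have i0 : 0 <= i%:R :> R by [].
have c0 : 0 < (i%:R + 1) / 3 :> R by rewrite divr_gt0// ltr_wpDl.
have d0 : 0 < (i%:R + 2) / 3 :> R by rewrite divr_gt0// ltr_wpDl.
have ad0 : 0 < mu / 3 + (i%:R + 2) / 3.
  by rewrite -mulrDl divr_gt0// addrCA ltr_wpDl//; move: hmu; lra.
have bE : 2 / 3 = (i%:R + 1) / 3 + 1 - (i%:R + 2) / 3 :> R by field.
have [] := kummerU_moment a1 c0 d0 ad0 bE.
rewrite (_ : mu / 3 + _ = (mu + 2 + i%:R) / 3); last by field.
set W := (fun x : R => _) => iW eW.
pose K : R := 3 * Gamma ((mu + 2) / 3) / (Gamma (1 / 3) * Gamma (2 / 3)).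
have E t : D t -> t ^+ i * calU0 mu t = K * W t.
  rewrite half_lineE => t0; rewrite /W /calU0 -/K.
  rewrite (_ : 3 * _ - 1 = i%:R); last by field.
  by rewrite powR_mulrn ?(ltW t0)//; ring.
split.
  apply: eq_integrable (integrable_scale K (@measurable_half_line R) iW) => //.
  by move=> t; rewrite inE /= => Dt; rewrite E.
transitivity (\int[nu]_(t in D) (K * W t)).
  by apply: eq_Rintegral => t; rewrite inE; exact: E.
by rewrite half_line_RintegralZl// eW.
Qed.

(** Here [a = mu/3 + 1], [c = (i+3)/3] and [d = (i+1)/3]; the factor [x ^+ 2] of the weight makes
    [3c - 1] equal to [i + 2]. *)
Lemma calU1_moment i :
  nu.-integrable D (EFin \o (fun t => t ^+ i * calU1 mu t)) /\
  \int[nu]_(t in D) (t ^+ i * calU1 mu t) =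
    9 * Gamma ((mu + 5) / 3) / (Gamma (1 / 3) * Gamma (2 / 3)) *
    (Gamma ((i%:R + 3) / 3) * Gamma ((i%:R + 1) / 3) / (3 * Gamma ((mu + 4 + i%:R) / 3))).
Proof.
have a1 : -1 < mu / 3 + 1 by move: hmu; lra.
have i0 : 0 <= i%:R :> R by [].
have c0 : 0 < (i%:R + 3) / 3 :> R by rewrite divr_gt0// ltr_wpDl.
have d0 : 0 < (i%:R + 1) / 3 :> R by rewrite divr_gt0// ltr_wpDl.
have ad0 : 0 < mu / 3 + 1 + (i%:R + 1) / 3 by rewrite addr_gt0//; move: hmu; lra.
have bE : 5 / 3 = (i%:R + 3) / 3 + 1 - (i%:R + 1) / 3 :> R by field.
have [] := kummerU_moment a1 c0 d0 ad0 bE.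
rewrite (_ : mu / 3 + 1 + _ = (mu + 4 + i%:R) / 3); last by field.
set W := (fun x : R => _) => iW eW.
pose K : R := 9 * Gamma ((mu + 5) / 3) / (Gamma (1 / 3) * Gamma (2 / 3)).
have E t : D t -> t ^+ i * calU1 mu t = K * W t.
  rewrite half_lineE => t0; rewrite /W /calU1 -/K.
  rewrite (_ : 3 * _ - 1 = (i + 2)%N%:R); last by rewrite natrD; field.
  by rewrite powR_mulrn ?(ltW t0)// exprD; ring.
split.
  apply: eq_integrable (integrable_scale K (@measurable_half_line R) iW) => //.
  by move=> t; rewrite inE /= => Dt; rewrite E.
transitivity (\int[nu]_(t in D) (K * W t)).
  by apply: eq_Rintegral => t; rewrite inE; exact: E.
by rewrite half_line_RintegralZl// eW.
Qed.

Definition weight (k : 'I_2) t : R := if k == ord0 then calU0 mu t else calU1 mu t.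

Definition moment (k : 'I_2) i : R := \int[nu]_(t in D) (t ^+ i * weight k t).

Lemma weight_integrable k i : nu.-integrable D (EFin \o (fun t => t ^+ i * weight k t)).
Proof.
rewrite /weight; case: (k == ord0).
  by have [] := calU0_moment i.
by have [] := calU1_moment i.
Qed.

(** The prefactors of the weights turn the Gamma quotients into rising factorials. For [k = 1] the
    constant 9 instead of 3 compensates [Gamma (4/3) = Gamma (1/3) / 3]. *)
Lemma momentE (k : 'I_2) m : moment k (3 * m + k) =
  (3 * m + k)`!%:R / (27 ^+ m * m`!%:R * rising ((mu + 2) / 3 + k%:R) m).
Proof.
have g13 : Gamma (1 / 3) != 0 :> R by rewrite lt0r_neq0// Gamma_gt0.
have g23 : Gamma (2 / 3) != 0 :> R by rewrite lt0r_neq0// Gamma_gt0.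
have m0 : m`!%:R != 0 :> R by rewrite pnatr_eq0 -lt0n fact_gt0.
have m27 : 27 ^+ m != 0 :> R by rewrite expf_neq0// pnatr_eq0.
rewrite /moment /weight; have [k0|k0] := eqVneq k ord0.
  rewrite k0 /= addn0 addr0 (calU0_moment _).2 fact3_rising natrM.
  have c0 : 0 < (mu + 2) / 3 by move: hmu; lra.
  rewrite (_ : (3 * m%:R + 1) / 3 = 1 / 3 + m%:R); last by field.
  rewrite (_ : (3 * m%:R + 2) / 3 = 2 / 3 + m%:R); last by field.
  rewrite (_ : (mu + 2 + 3 * m%:R) / 3 = (mu + 2) / 3 + m%:R); last by field.
  rewrite !Gamma_rising//.
  have := rising_gt0 m c0; have := Gamma_gt0 c0 => /lt0r_neq0 + /lt0r_neq0.
  move: (Gamma ((mu + 2) / 3)) (Gamma (1 / 3)) (Gamma (2 / 3)) g13 g23 => G1 G2 G3 h1 h2 h3 h4.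
  by field; rewrite m0 m27 h1 h2 h3 h4.
have -> : k = 1%N :> nat by case: k k0 => -[|[|]].
rewrite (calU1_moment _).2 fact31_rising natrD natrM.
have c0 : 0 < (mu + 5) / 3 by move: hmu; lra.
rewrite (_ : (3 * m%:R + 1 + 3) / 3 = 4 / 3 + m%:R); last by field.
rewrite (_ : (3 * m%:R + 1 + 1) / 3 = 2 / 3 + m%:R); last by field.
rewrite (_ : (mu + 4 + (3 * m%:R + 1)) / 3 = (mu + 5) / 3 + m%:R); last by field.
rewrite (_ : (mu + 2) / 3 + 1 = (mu + 5) / 3); last by field.
have p3 : 0 < 1 / 3 :> R by [].
have p43 : 4 / 3 = 1 / 3 + 1 :> R by field.
rewrite !Gamma_rising// [in Gamma (4 / 3)]p43 (Gamma_rec p3).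
have := rising_gt0 m c0; have := Gamma_gt0 c0 => /lt0r_neq0 + /lt0r_neq0.
move: (Gamma ((mu + 5) / 3)) (Gamma (1 / 3)) (Gamma (2 / 3)) g13 g23 => G1 G2 G3 h1 h2 h3 h4.
by field; rewrite m0 m27 h1 h2 h3 h4.
Qed.

End moments.

(** * The three rays: filter modulo 3 *)

Section omega.
Variable R : realType.
Local Notation C := R[i].
Local Notation w := (omega R).

Lemma ReMr (z : C) (r : R) : complex.Re (z * r%:C) = complex.Re z * r.
Proof. by case: z => x y /=; rewrite mulr0 subr0. Qed.

Lemma ImMr (z : C) (r : R) : complex.Im (z * r%:C) = complex.Im z * r.
Proof. by case: z => x y /=; rewrite mulr0 add0r. Qed.

Lemma omega_cube : w ^+ 3 = 1.
Proof.
rewrite /omega; set t := 2 * pi / 3.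
have t3 : t + (t + t) = pi *+ 2 by rewrite /t mulr2n; field.
rewrite exprS expr2; apply/eqP; rewrite eq_complex/=; apply/andP; split; apply/eqP.
  by rewrite -(cos2pi R) -t3 cosD sinD cosD; ring.
by rewrite -(sin2pi R) -t3 sinD cosD sinD; ring.
Qed.

Lemma omega_sum : w ^+ 2 + w + 1 = 0.
Proof.
have w1 : w - 1 != 0.
  rewrite subr_eq0 /omega eq_complex/= negb_and; apply/orP; right.
  apply: lt0r_neq0; apply: sin_gt0_pi; have := pi_gt0 R.
  by move=> h; apply/andP; split; lra.
apply: (mulfI w1); rewrite mulr0 (_ : _ * _ = w ^+ 3 - 1); last by ring.
by rewrite omega_cube subrr.
Qed.

Lemma omega_neq0 : w != 0.
Proof.
have := omega_cube; apply: contra_eq_neq => ->.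
by rewrite expr0n eq_sym oner_neq0.
Qed.

(** The factor by which the three rays together multiply the [i]-th moment; the exponent [i.+1]
    includes the [w] of [dz = w dt]. *)
Definition character (k i : nat) : C :=
  3^-1 * (1 + w ^ (2 * k%:Z - 1) * w ^+ i.+1 + w ^ (1 - 2 * k%:Z) * w ^+ (2 * i.+1)).

(** Modulo 3 the exponents are [i + 2k] and its double, so the bracket is a sum of cube roots of
    unity, equal to 3 exactly when [i + 2k] is divisible by 3, that is when [i] is congruent to
    [k]. *)
Lemma characterE (k : 'I_2) i : character k i = ((i %% 3)%N == k)%:R.
Proof.
have w0 := omega_neq0; have w3 := omega_cube; have ws := omega_sum.
have wq q s : w ^+ (3 * q + s) = w ^+ s by rewrite exprD exprM w3 expr1n mul1r.
have three : (3 : C) != 0 by rewrite pnatr_eq0.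
set q := (i %/ 3)%N; set s := (i %% 3)%N.
have s3 : (s < 3)%N by rewrite ltn_mod.
have is_ : (i = 3 * q + s)%N by rewrite mulnC -divn_eq.
have wN n : w ^ (-1) * w ^+ n.+1 = w ^+ n.
  by rewrite exprN1 exprS mulKf.
have E : character k i = 3^-1 * (1 + w ^+ (s + 2 * k) + w ^+ (2 * s + 4 * k)).
  rewrite /character; case: k => -[|[|//]] ? /=.
    rewrite mulr0 sub0r subr0 expr1z wN mulnS exprD mulrA -exprS w3 mul1r.
    rewrite !muln0 !addn0 is_ wq (_ : 2 * (3 * q + s) = 3 * (2 * q) + 2 * s)%N ?wq//; lia.
  rewrite mulr1 (_ : 2 - 1 = 1 :> int)// (_ : 1 - 2 = -1 :> int)// expr1z.
  rewrite -exprS (_ : 2 * i.+1 = (2 * i).+2)%N ?wN; last by lia.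
  rewrite is_ (_ : (3 * q + s).+2 = 3 * q + (s + 2))%N ?wq; last by lia.
  rewrite (_ : (2 * (3 * q + s)).+1 = 3 * (2 * q) + (2 * s + 1))%N ?wq; last by lia.
  by rewrite (_ : 2 * s + 4 * 1 = 3 * 1 + (2 * s + 1))%N ?wq//; lia.
rewrite {}E; clearbody s q; clear is_.
have w4 : w ^+ 4 = w by rewrite exprS w3 mulr1.
have w6 : w ^+ 6 = 1 by rewrite (exprM w 3 2) w3 expr1n.
have w8 : w ^+ 8 = w ^+ 2 by rewrite (exprD w 6 2) w6 mul1r.
have S1 : 1 + w + w ^+ 2 = 0 by rewrite -ws; ring.
have S2 : 1 + w ^+ 2 + w = 0 by rewrite -ws; ring.
have S3 : (1 + 1 + 1 : C) = 3 by ring.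
case: k s s3 => -[|[|//]] ? [|[|[|//]]] _ /=; rewrite ?muln0 ?muln1 ?addn0 ?add0n ?expr0 ?expr1.
- by rewrite S3 mulVf.
- by rewrite S1 mulr0.
- by rewrite w4 S2 mulr0.
- by rewrite w4 S2 mulr0.
- by rewrite w3 w6 S3 mulVf.
- by rewrite w4 w8 S1 mulr0.
Qed.

End omega.

Section functional.
Variables (R : realType) (mu : R).
Hypothesis hmu : -1 < mu.

Local Notation nu := (@lebesgue_measure R).
Local Notation D := (`]0, +oo[%classic : set R).
Local Notation C := R[i].
Local Notation w := (omega R).

(** Since [u' * u = 1], the weight is evaluated at the real number [t] on every ray, and only the
    polynomial feels the rotation. The bound [n] is left free so that several polynomials can share
    one range of summation. *)
Lemma ray_moments (k : 'I_2) (f : {poly C}) n (u u' : C) (g : C -> C) :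
  (size f <= n)%N -> u' * u = 1 -> (forall z, g z = f.[z] * calU mu k (u' * z)) ->
  ray_integrable u g /\
  ray_integral u g = u * \sum_(i < n) f`_i * u ^+ i * (moment mu k i)%:C.
Proof.
move=> fn uu gE.
have gt t : g (t%:C * u) = \sum_(0 <= i < n) (f`_i * u ^+ i * (t ^+ i * weight mu k t)%:C).
  rewrite gE mulrCA uu mulr1 (horner_coef_wide _ fn) mulr_suml big_mkord.
  apply: eq_bigr => i _; rewrite /calU /weight /= exprMn rmorphM rmorphXn /=.
  by case: (k == ord0); ring.
have ii := weight_integrable hmu k.
pose gr i t := complex.Re (f`_i * u ^+ i) * (t ^+ i * weight mu k t).
pose gi i t := complex.Im (f`_i * u ^+ i) * (t ^+ i * weight mu k t).
have [ri re] : nu.-integrable D (EFin \o (fun t => \sum_(0 <= i < n) gr i t)) /\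
   \int[nu]_(t in D) (\sum_(0 <= i < n) gr i t) = \sum_(0 <= i < n) \int[nu]_(t in D) gr i t.
  by apply: Rintegral_sum => i; apply: integrable_scale; [exact: measurable_half_line|exact: ii].
have [mi me] : nu.-integrable D (EFin \o (fun t => \sum_(0 <= i < n) gi i t)) /\
   \int[nu]_(t in D) (\sum_(0 <= i < n) gi i t) = \sum_(0 <= i < n) \int[nu]_(t in D) gi i t.
  by apply: Rintegral_sum => i; apply: integrable_scale; [exact: measurable_half_line|exact: ii].
have Rg : (fun t : R => complex.Re (g (t%:C * u))) = (fun t => \sum_(0 <= i < n) gr i t).
  apply/funext => t; rewrite gt (raddf_sum (@complex.Re R)).
  by apply: eq_bigr => i _; exact: ReMr.
have Ig : (fun t : R => complex.Im (g (t%:C * u))) = (fun t => \sum_(0 <= i < n) gi i t).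
  apply/funext => t; rewrite gt (raddf_sum (@complex.Im R)).
  by apply: eq_bigr => i _; exact: ImMr.
split; first by rewrite /ray_integrable Rg Ig.
rewrite /ray_integral Rg Ig re me; congr (_ * _).
apply/eqP; rewrite eq_complex/=; apply/andP; split; apply/eqP.
  rewrite (raddf_sum (@complex.Re R)) big_mkord; apply: eq_bigr => i _.
  by rewrite (half_line_RintegralZl _ (ii i)); apply/esym/ReMr.
rewrite (raddf_sum (@complex.Im R)) big_mkord; apply: eq_bigr => i _.
by rewrite (half_line_RintegralZl _ (ii i)); apply/esym/ImMr.
Qed.

Lemma ray_moments0 (k : 'I_2) (f : {poly C}) n : (size f <= n)%N ->
  ray_integrable 1 (fun z => f.[z] * calU mu k z) /\
  ray_integral 1 (fun z => f.[z] * calU mu k z) =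
    1 * \sum_(i < n) f`_i * 1 ^+ i * (moment mu k i)%:C.
Proof.
by move=> fn; apply: (ray_moments fn (mulr1 1)) => z; rewrite (mul1r z).
Qed.

Let ww1 : w ^+ 2 * w = 1. Proof. by rewrite -exprSr omega_cube. Qed.
Let ww2 : w * w ^+ 2 = 1. Proof. by rewrite -exprS omega_cube. Qed.

Lemma functional_integrableT (k : 'I_2) (f : {poly C}) : functional_integrable mu k f.
Proof.
split.
- exact: (ray_moments0 k (leqnn (size f))).1.
- exact: (ray_moments (leqnn (size f)) ww1 (fun=> erefl)).1.
- exact: (ray_moments (leqnn (size f)) ww2 (fun=> erefl)).1.
Qed.

Lemma functionalE (k : 'I_2) (f : {poly C}) n : (size f <= n)%N ->
  functional mu k f = \sum_(i < n) f`_i * (character R k i * (moment mu k i)%:C).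
Proof.
move=> fn; rewrite /functional.
rewrite (ray_moments0 k fn).2 (ray_moments fn ww1 (fun=> erefl)).2.
rewrite (ray_moments fn ww2 (fun=> erefl)).2.
rewrite mul1r !mulrA !mulr_sumr -!big_split/= mulr_sumr; apply: eq_bigr => i _.
by rewrite /character expr1n mulr1 exprM (exprS w i) (exprS (w ^+ 2) i); ring.
Qed.

Lemma functional_scalar (k : 'I_2) : scalar (functional mu k).
Proof.
move=> a p q; pose n := maxn (size p) (size q).
rewrite (@functionalE k p n) ?leq_maxl// (@functionalE k q n) ?leq_maxr//.
rewrite (@functionalE k (a *: p + q) n); last first.
  by rewrite (leq_trans (size_polyD _ _))// geq_max leq_maxr (leq_trans (size_scale_leq _ _))// leq_maxl.
rewrite mulr_sumr -big_split; apply: eq_bigr => i _ /=.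
by rewrite coefD coefZ; ring.
Qed.

Lemma functionalX (k : 'I_2) j : functional mu k 'X^j = character R k j * (moment mu k j)%:C.
Proof.
rewrite (@functionalE k _ j.+1) ?size_polyXn// big_ord_recr /= coefXn eqxx mul1r.
rewrite big1 ?add0r// => i _; rewrite coefXn.
by rewrite (ltn_eqF (ltn_ord i)) mul0r.
Qed.

End functional.

Theorem proposition3p11 (R : realType) (mu : R) (hmu : -1 < mu)
    (gamma : nat -> R)
    (hgamma_odd : forall n : nat,
       gamma (2 * n + 1)%N =
         2 / 3 * ((n%:R + 1) * (2 * n%:R + 1)) / (3 * n%:R + mu + 2))
    (hgamma_even : forall n : nat,
       gamma (2 * n + 2)%N =
         2 / 3 * ((n%:R + 1) * (2 * n%:R + 3) * (n%:R + mu + 1))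
               / ((3 * n%:R + mu + 2) * (3 * n%:R + mu + 5)))
    (P : nat -> {poly R[i]})
    (hP0 : P 0%N = 1) (hP1 : P 1%N = 'X) (hP2 : P 2%N = 'X^2)
    (hP : forall n : nat, (2 <= n)%N ->
       P (n + 1)%N = 'X * P n - (gamma (n - 1)%N)%:C *: P (n - 2)%N) :
  [/\ threefold_symmetric P,
      forall (k : 'I_2) (f : {poly R[i]}), functional_integrable mu k f &
      two_orthogonal (functional mu (inord 0)) (functional mu (inord 1)) P].
Proof.
(* The polynomial part holds over any [numFieldType]. The partial order of [R[i]] compares real
   numbers, so it can be applied directly with the parameter [mu%:C]. *)
have hmuC : -1 < mu%:C :> R[i] by rewrite -(rmorphN1 (real_complex R)) ltcR.
have goddC n : (gamma (2 * n + 1)%N)%:C =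
    2 / 3 * ((n%:R + 1) * (2 * n%:R + 1)) / (3 * n%:R + mu%:C + 2).
  by rewrite hgamma_odd !(rmorphM, rmorphD, fmorphV, rmorph1, rmorph_nat).
have gevenC n : (gamma (2 * n + 2)%N)%:C =
    2 / 3 * ((n%:R + 1) * (2 * n%:R + 3) * (n%:R + mu%:C + 1))
          / ((3 * n%:R + mu%:C + 2) * (3 * n%:R + mu%:C + 5)).
  by rewrite hgamma_even !(rmorphM, rmorphD, fmorphV, rmorph1, rmorph_nat).
pose gC n := (gamma n)%:C.
have dual (r n : nat) : (r < 2)%N -> functional mu (inord r) (P n) = (n == r)%:R.
  move=> r2; have rE : (inord r : 'I_2) = r :> nat by rewrite inordK.
  apply: (@hpoly_dual _ _ hmuC gC goddC gevenC P hP0 hP1 hP2 hP) => //.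
  - exact: (functional_scalar hmu).
  - by move=> i ir; rewrite functionalX// characterE rE (negbTE ir) mul0r.
  - move=> m; rewrite functionalX// characterE rE (_ : (3 * m + r) %% 3 = r)%N; last by lia.
    have := momentE hmu (inord r : 'I_2) m; rewrite rE eqxx mul1r => ->.
    rewrite !(rmorphM, fmorphV, rmorphXn, rmorph_nat)/=; congr (_ / (_ * _)).
    rewrite /rising rmorph_prod; apply: eq_bigr => i _.
    by rewrite !(rmorphM, rmorphD, fmorphV, rmorph_nat).
split.
- move=> n x; rewrite (@hpolyE _ _ hmuC gC goddC gevenC P hP0 hP1 hP2 hP).
  rewrite !horner_sum mulr_sumr; apply: eq_bigr => k _.
  rewrite !hornerZ !hornerXn; have [h|h] := leqP (3 * k) n; last first.
    by rewrite hcoef_small// !mul0r mulr0.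
  (* All exponents of [P n] are of the form [n - 3k], and [omega R ^+ 3 = 1]. *)
  have -> : omega R ^+ n = omega R ^+ (n - 3 * k).
    by rewrite -{1}(subnK h) exprD exprM omega_cube expr1n mulr1.
  by rewrite exprMn; ring.
- exact: (functional_integrableT hmu).
- apply: (@hpoly_two_orthogonal _ _ hmuC gC goddC gevenC P hP0 hP1 hP2 hP).
  + exact: (functional_scalar hmu).
  + exact: (functional_scalar hmu).
  + by move=> n; exact: dual.
  + by move=> n; exact: dual.
Qed.
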